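(* Let $1\le p<\infty$ and let $(X,\mu)$ be a positive Borel measure space (a topological space $X$ with a positive Borel measure $\mu$) such that $S_p(X)$ is nonvoid. Then $S_p(X\times[0,1])$ is $\ell_2$-spaceable in $L^p(X\times[0,1])$; that is, $S_p(X\times[0,1])\cup\{0\}$ contains a closed linear subspace of $L^p(X\times[0,1])$ isomorphic to $\ell_2$.
   Context: Topological spaces are nonempty; functions are real-valued. $[0,1]$ carries Lebesgue measure, and $X\times[0,1]$ carries the product topology and the product of $\mu$ with Lebesgue measure. For $0<q\le\infty$, a function $f$ on a Borel measure space $Y$ is nowhere $L^q$ if for each nonvoid open $U\subset Y$ the restriction $f|_U$ is not in $L^q(U)$. For a Borel measure space $Y$ and $0<p<\infty$, $$S_p(Y)=\{f\in L^p(Y): f\text{ is nowhere }L^q\text{ for each }p<q\le\infty\}.$$ Isomorphic means linearly homeomorphic. A subset $S$ of a topological vector space $V$ is $W$-spaceable if $S\cup\{0\}$ contains a subspace of $V$ isomorphic to $W$. *)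

(* Defs.v *)
From HB Require Import structures.
From mathcomp Require Import all_boot all_order all_algebra ring_quotient.
From mathcomp Require Import all_classical all_reals all_analysis.
From mathcomp Require Import ess_sup_inf measurable_realfun.

Set Implicit Arguments.
Unset Strict Implicit.
Unset Printing Implicit Defensive.
Import Order.TTheory GRing.Theory Num.Theory.
Import numFieldTopology.Exports numFieldNormedType.Exports.

Local Open Scope classical_set_scope.
Local Open Scope ring_scope.
Local Open Scope quotient_scope.

Section ae_zero.
Context d (T : measurableType d) (R : realType).
Variables (mu : {measure set T -> \bar R}) (p : \bar R) (p1 : (1 <= p)%E).
Implicit Types f g : LfunType mu p1.

Lemma Lnorm_ae0 f : (f : T -> R) = cst 0 %[ae mu] ->
  'N[mu]_p[EFin \o f]%E = 0%E.
Proof.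
move=> f0; have p0 : (p != 0)%E by rewrite gt_eqF// (lt_le_trans _ p1).
have mf : measurable_fun setT (f : T -> R) by [].
case: p p1 p0 f f0 mf => [r r1 r0|y1 _|//] f f0 mf; last first.
  rewrite unlock; case: ifPn => // mu0; apply: ess_sup_ae_cst => //.
  by apply: filterS f0 => x /(_ I) /= ->; rewrite normr0.
rewrite unlock (ae_eq_integral (cst 0%E)) ?integral0 ?poweR0r ?invr_neq0//.
- apply: (measurableT_comp (measurable_poweR r)).
  by apply: measurableT_comp => //; exact: measurableT_comp.
- by apply: filterS f0 => x /(_ I) /= -> _; rewrite normr0 powR0.
Qed.

Definition ae_zero : {pred LfunType mu p1} :=
  [pred f : LfunType mu p1 | `[< (f : T -> R) = cst 0 %[ae mu] >]].

Lemma ae_zero_zmod_closed : zmod_closed ae_zero.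
Proof.
split; first by apply/asboolP; apply: aeW.
move=> f g /asboolP f0 /asboolP g0; apply/asboolP.
apply: filterS2 f0 g0 => x /(_ I) /= f0 /(_ I) /= g0 _ /=.
by rewrite -[LHS]/(f x - g x) f0 g0 subr0.
Qed.

HB.instance Definition _ :=
  GRing.isZmodClosed.Build (LfunType mu p1) ae_zero ae_zero_zmod_closed.

End ae_zero.
Arguments ae_zero {d T R} mu {p} p1 : simpl never.

(* The library's [LspaceType] carries no vector space or norm structure. *)
Definition Lp d (T : measurableType d) (R : realType)
    (mu : {measure set T -> \bar R}) (p : \bar R) (p1 : (1 <= p)%E) : Type :=
  Quotient.quot (ae_zero mu p1).

Section Lp_normed.
Context d (T : measurableType d) (R : realType).
Variables (mu : {measure set T -> \bar R}) (p : \bar R) (p1 : (1 <= p)%E).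
Local Notation E := (Lp mu p1).
Local Notation F := (LfunType mu p1).

HB.instance Definition _ := GRing.Zmodule.on E.

Definition Lp_class (f : F) : E := \pi_(Quotient.quot (ae_zero mu p1)) f.
Definition Lp_repr (x : E) : F := repr (x : Quotient.quot (ae_zero mu p1)).

Lemma Lp_reprK : cancel Lp_repr Lp_class. Proof. exact: reprK. Qed.

Lemma Lp_classB f g : Lp_class (f - g) = Lp_class f - Lp_class g.
Proof. by rewrite /Lp_class !piE. Qed.

Lemma Lp_classD f g : Lp_class (f + g) = Lp_class f + Lp_class g.
Proof. by rewrite /Lp_class !piE. Qed.

Lemma Lp_classP f g :
  Lp_class f = Lp_class g <-> (f : T -> R) = g %[ae mu].
Proof.
have -> : (Lp_class f = Lp_class g) <-> (f - g \in ae_zero mu p1).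
  rewrite Quotient.idealrBE; split; first by move=> fg; apply/eqP.
  by move/eqP.
split.
- move=> /asboolP; apply: filterS => x /(_ I) /= fg _.
  by apply/eqP; rewrite -subr_eq0; exact/eqP.
- move=> fg; apply/asboolP; apply: filterS fg => x /(_ I) /= fg _.
  by rewrite -[LHS]/(f x - g x) fg subrr.
Qed.

Let scale (a : R) (x : E) : E := Lp_class (a *: Lp_repr x).

Lemma Lp_reprE f : (Lp_repr (Lp_class f) : T -> R) = f %[ae mu].
Proof. by apply/Lp_classP; rewrite Lp_reprK. Qed.

Lemma scale_class a f : scale a (Lp_class f) = Lp_class (a *: f).
Proof.
apply/Lp_classP; apply: filterS (Lp_reprE f) => x /(_ I) /= fx _.
by rewrite -[LHS]/(a * _) fx.
Qed.

Let scaleA a b x : scale a (scale b x) = scale (a * b) x.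
Proof. by rewrite -[x]Lp_reprK !scale_class scalerA. Qed.

Let scale1 : left_id 1 scale.
Proof. by move=> x; rewrite -[x]Lp_reprK !scale_class scale1r. Qed.

Let scaleDr : right_distributive scale +%R.
Proof.
move=> a x y; rewrite -[x]Lp_reprK -[y]Lp_reprK.
by rewrite -Lp_classD !scale_class scalerDr Lp_classD.
Qed.

Let scaleDl x : {morph scale^~ x : a b / a + b}.
Proof.
by move=> a b /=; rewrite -[x]Lp_reprK !scale_class scalerDl Lp_classD.
Qed.

HB.instance Definition _ := GRing.Zmodule_isLmodule.Build R E
  scaleA scale1 scaleDr scaleDl.

Lemma Lp_classZ a f : Lp_class (a *: f) = a *: Lp_class f.
Proof. by rewrite -scale_class. Qed.

Definition Lp_norm (x : E) : R := fine ('N[mu]_p[EFin \o Lp_repr x]%E).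

Lemma Lp_norm_class f : Lp_norm (Lp_class f) = fine ('N[mu]_p[EFin \o f]%E).
Proof.
have le f1 f2 : Lp_class f1 = Lp_class f2 ->
    fine ('N[mu]_p[EFin \o f1]%E) <= fine ('N[mu]_p[EFin \o f2]%E).
  move=> /eqP; rewrite -subr_eq0 -Lp_classB => /eqP f12.
  have /Lp_classP /Lnorm_ae0 N0 : Lp_class (f1 - f2) = Lp_class 0.
    by rewrite f12 /Lp_class piE.
  rewrite -{1}(subrK f2 f1) (le_trans (ler_LnormD _ _))// N0 add0r.
  by [].
by apply/eqP; rewrite eq_le !le// Lp_reprK.
Qed.

Let ler_Lp_normD x y : Lp_norm (x + y) <= Lp_norm x + Lp_norm y.
Proof.
rewrite -[x]Lp_reprK -[y]Lp_reprK -Lp_classD !Lp_norm_class.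
exact: ler_LnormD.
Qed.

Let Lp_normZ a x : Lp_norm (a *: x) = `|a| * Lp_norm x.
Proof.
rewrite -[x]Lp_reprK -Lp_classZ !Lp_norm_class.
by apply/EFin_inj; rewrite EFinM !finite_norm_fine LnormZ.
Qed.

Let Lp_norm_eq0 x : Lp_norm x = 0 -> x = 0.
Proof.
move=> /fine_Lnormr_eq0 x0; rewrite -[x]Lp_reprK.
suff -> : 0 = Lp_class 0 by apply/Lp_classP.
by rewrite /Lp_class piE.
Qed.

HB.instance Definition _ := Lmodule_isNormed.Build R E
  ler_Lp_normD Lp_normZ Lp_norm_eq0.

End Lp_normed.

Section spaceable.
Context (R : realType).

Definition isomorphic_onto (W V : topologicalLmodType R) (M : set V) :=
  exists (f : {linear W -> V}) (g : V -> W),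
    [/\ continuous f, range f = M, cancel f g & {within M, continuous g}].

Definition spaceable (W V : topologicalLmodType R) (S : set V) :=
  exists M : set V,
    [/\ submod_closed [in M], M `<=` S `|` [set 0] & isomorphic_onto W M].

End spaceable.
Arguments isomorphic_onto {R} W {V} M.
Arguments spaceable {R} W {V} S.

HB.instance Definition _ (X Y : ptopologicalType) := Topological.on (X * Y)%type.

Notation borel X := (g_sigma_algebraType (@open X)).

Section S_p.
Context (R : realType) (Y : ptopologicalType).
Variable mu : {measure set (borel Y) -> \bar R}.

(* [f \_ U] is [f] extended by [0] outside [U]: since [U] is measurable, it
   belongs to L^q(Y) exactly when the restriction of [f] belongs to L^q(U). *)
Definition nowhere_L (q : \bar R) (f : borel Y -> R) :=
  forall U : set Y, open U -> U !=set0 -> f \_ U \notin Lfun mu q.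

(* Being nowhere L^q is invariant under almost everywhere equality, so a class
   is in [Sp] as soon as one of its representatives has the property. *)
Definition Sp (p : R) (p1 : (1 <= p%:E)%E) : set (Lp mu p1) :=
  [set Lp_class f | f in
    [set f : LfunType mu p1 | forall q, (p%:E < q)%E -> nowhere_L q f]].

End S_p.
Arguments Sp {R Y} mu {p} p1.

Definition unit_interval (R : realType) : Type :=
  set_type (`[0, 1]%classic : set R).

Section unit_interval.
Context (R : realType).
Local Notation I := (unit_interval R).

HB.instance Definition _ := PseudoMetric.on I.

Let zero_in : (0 : R) \in (`[0, 1]%classic : set R).
Proof. by rewrite inE /= in_itv /= lexx ler01. Qed.

HB.instance Definition _ := isPointed.Build I (exist _ 0 zero_in).

Definition unit_val : I -> R := set_val.

Definition lebesgue01 (A : set (borel I)) : \bar R :=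
  lebesgue_measure (unit_val @` A).

Lemma unit_val_inj : injective unit_val.
Proof. by move=> x y; exact: val_inj. Qed.

Lemma range_unit_val : range unit_val = `[0, 1]%classic.
Proof.
apply/seteqP; split=> [_ [x _ <-]|x x01]; first exact: set_valP.
by exists (exist _ x (mem_set x01)).
Qed.

Lemma measurable_image_unit_val (A : set (borel I)) :
  measurable A -> measurable (unit_val @` A : set R).
Proof.
suff : <<s @open I >> `<=` [set A | measurable (unit_val @` A : set R)].
  by apply.
apply: smallest_sub; last first.
  move=> _ [V oV <-] /=; rewrite [X in measurable X](_ : _ = V `&` `[0, 1]).
    by apply: measurableI => //; exact: open_measurable.
  apply/seteqP; split=> [_ [x Vx <-]|x [Vx x01]].
    by split => //; exact: set_valP.
  by exists (exist _ x (mem_set x01)).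
split => /=.
- by rewrite image_set0.
- move=> B mB; rewrite setTD -[X in measurable X]/(unit_val @` (~` B)).
  rewrite [X in measurable X](_ : _ = `[0, 1]%classic `\` unit_val @` B).
    exact: measurableD.
  rewrite -range_unit_val; apply/seteqP; split.
    move=> _ [x nBx <-]; split; first by exists x.
    by move=> [y By /unit_val_inj yx]; apply: nBx; rewrite -yx.
  move=> _ [[x _ <-] nB]; exists x => // Bx; apply: nB; by exists x.
- by move=> F mF; rewrite image_bigcup; exact: bigcupT_measurable.
Qed.

Let lebesgue01_0 : lebesgue01 set0 = 0%E.
Proof. by rewrite /lebesgue01 image_set0 measure0. Qed.

Let lebesgue01_ge0 A : (0 <= lebesgue01 A)%E.
Proof. exact: measure_ge0. Qed.

Let lebesgue01_sigma_additive : semi_sigma_additive lebesgue01.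
Proof.
move=> F mF tF mUF; rewrite /lebesgue01 image_bigcup.
apply: measure_semi_sigma_additive => [n||].
- exact: measurable_image_unit_val.
- apply/trivIsetP => i j _ _ ij.
  rewrite -subset0 => _ [[x Fx <-] [y Fy /unit_val_inj yx]].
  move/trivIsetP : tF => /(_ i j Logic.I Logic.I ij) Fij.
  suff : set0 x by [].
  by rewrite -Fij; split=> //; rewrite -yx.
- by apply: bigcupT_measurable => n; exact: measurable_image_unit_val.
Qed.

HB.instance Definition _ := isMeasure.Build _ _ _ lebesgue01
  lebesgue01_0 lebesgue01_ge0 lebesgue01_sigma_additive.

Let lebesgue01_setT : lebesgue01 setT = 1%E.
Proof.
by rewrite /lebesgue01 range_unit_val lebesgue_measure_itv /= lte01 oppr0 adde0.
Qed.

HB.instance Definition _ := Measure_isProbability.Build _ _ _ lebesgue01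
  lebesgue01_setT.

Definition rat_itv (ab : rat * rat) : set I :=
  unit_val @^-1` `]ratr ab.1, ratr ab.2[%classic.

Lemma open_rat_itv ab : open (rat_itv ab).
Proof.
by exists (`]ratr ab.1, ratr ab.2[%classic : set R) => //; exact: interval_open.
Qed.

Lemma rat_itv_basis (y : I) (Q : set I) :
  nbhs y Q -> exists2 ab, rat_itv ab y & rat_itv ab `<=` Q.
Proof.
move=> [_ [[B oB <-] By] BQ].
have /nbhs_ballP[_/posnumP[e] eB] : nbhs (unit_val y) B by exact: open_nbhs_nbhs.
have /rat_in_itvoo[a a_in] : unit_val y - e%:num < unit_val y.
  by rewrite ltrBlDr ltrDl.
have /rat_in_itvoo[b b_in] : unit_val y < unit_val y + e%:num by rewrite ltrDl.
move: a_in b_in; rewrite !in_itv/= => /andP[ea ay] /andP[yb be].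
exists (a, b); first by rewrite /rat_itv /= in_itv /= ay yb.
move=> z; rewrite /rat_itv /= in_itv /= => /andP[az zb].
apply: BQ; apply: eB; rewrite /ball /= ltr_distlC.
by rewrite (lt_trans ea az) (lt_trans zb be).
Qed.

End unit_interval.

Section product_measure.
Context (R : realType) (X : ptopologicalType).
Variable mu : {measure set (borel X) -> \bar R}.
Local Notation I := (unit_interval R).

(* Since [0, 1] is second countable, the Borel sets of the product are measurable
   for the product of the Borel sigma-algebras. *)
Lemma borel_prod_measurable (A : set (borel (X * I)%type)) :
  measurable A -> measurable (A : set (borel X * borel I)%type).
Proof.
suff : <<s @open (X * I)%type >> `<=`
    (@measurable _ (borel X * borel I)%type : set (set (X * I))) by apply.
apply: smallest_sub; first exact: sigma_algebra_measurable.
move=> W oW.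
pose U ab := \bigcup_(B in [set B : set X | open B /\ B `*` @rat_itv R ab `<=` W]) B.
have -> : W = \bigcup_(ab in [set: rat * rat]) (U ab `*` @rat_itv R ab).
  apply/seteqP; split=> [[x y] Wxy|[x y]]; last first.
    by move=> [ab _ [/= [B [_ BW] Bx] aby]]; exact: BW.
  have : nbhs (x, y) W by exact: open_nbhs_nbhs.
  move=> [[P Q] /= [xP /rat_itv_basis[ab aby abQ]] PQW].
  exists ab => //; split => //=.
  exists P° => /=; last exact: xP.
  split; first exact: open_interior.
  move=> [x' y'] /= [Px' aby']; apply: PQW; split => /=; last exact: abQ.
  exact: interior_subset Px'.
apply: countable_bigcupT_measurable; first exact: countableP.
move=> ab.
apply: measurableX; apply: sub_sigma_algebra; last exact: open_rat_itv.
by apply: bigcup_open => B [].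
Qed.

(* [mu \x lebesgue01], restricted to the Borel sets of the product space. The
   measure [mu] need not be sigma-finite: [mu \x lebesgue01] sends [A] to the
   integral over [x] of the Lebesgue measure of the section of [A] at [x]. *)
Definition prod01 (A : set (borel (X * I)%type)) : \bar R :=
  (mu \x @lebesgue01 R)%E (A : set (borel X * borel I)%type).

Let prod01_0 : prod01 set0 = 0%E. Proof. exact: measure0. Qed.

Let prod01_ge0 A : (0 <= prod01 A)%E. Proof. exact: measure_ge0. Qed.

Let prod01_sigma_additive : semi_sigma_additive prod01.
Proof.
move=> F mF tF mUF; apply: measure_semi_sigma_additive => //.
- by move=> n; exact: borel_prod_measurable.
- exact: borel_prod_measurable.
Qed.

HB.instance Definition _ := isMeasure.Build _ _ _ prod01
  prod01_0 prod01_ge0 prod01_sigma_additive.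

Lemma prod01X (A : set (borel X)) (B : set (borel I)) :
  measurable A -> measurable B ->
  prod01 (A `*` B) = (mu A * lebesgue01 B)%E.
Proof. by move=> mA mB; exact: product_measure1E. Qed.

End product_measure.

(* The Lp space of the counting measure on [nat], where "almost everywhere" means
   "everywhere": square-summable real sequences with the l^2 norm. *)
Definition ell2 (R : realType) : normedModType R :=
  Lp (@counting nat R) (lee1n 2).

(* Main.v *)
Require Import Defs.
From HB Require Import structures.
From mathcomp Require Import all_boot all_order all_algebra.
From mathcomp Require Import all_classical all_reals all_analysis.
From mathcomp Require Import ess_sup_inf measurable_realfun.
From mathcomp Require Import lra ring zify.
Import Order.TTheory GRing.Theory Num.Theory.
Import numFieldTopology.Exports numFieldNormedType.Exports.
Local Open Scope classical_set_scope.
Local Open Scope ring_scope.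

Set Implicit Arguments.
Unset Strict Implicit.
Unset Printing Implicit Defensive.

(* Let f be in S_p(X) and let r_0, r_1, ... be the Rademacher functions on [0,1].
   By Khinchine's inequality b |-> sum_j b_j r_j embeds l^2 into L^p([0,1]), and
   tensoring with f multiplies norms by the norm of f. On an open rectangle
   U x V the L^q integral of f (x) g is the product of that of f over U, which
   is infinite, and that of g over V, so f (x) g is nowhere L^q as soon as g
   vanishes on no interval. A finite sum of Rademacher functions may vanish on an
   interval, but a sum with infinitely many nonzero coefficients cannot: r_k
   is orthogonal to every other r_j on each dyadic interval of generation at most
   k. Hence l^2 is first embedded in itself so that all nonzero images have
   infinitely many nonzero coefficients. *)

(** A sum such as [r_0 + r_1] vanishes on [1/4, 3/4[, which is why coefficients are spread out
    before being summed. Every finite Rademacher sum depends on [t] only through the number of a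
    dyadic interval, so its integrals are finite averages, and induction on the number of terms
    replaces independence. Khinchine's upper bound comes from exponential moments; the lower one
    compares the second moment, known exactly, with the p-th and the fourth. As [p] may be less than
    2, the coefficients of a limit in [L^p] are recovered through convergence in [L^1], by pairing
    with the bounded function [r_k] cut to a dyadic interval. The product formula settles finite [q]
    only; for [q = +oo], a function of [L^p] that is bounded on an open set would also be in
    [L^(p+1)] there. *)

(** * Completeness of [L^p] for finite exponents *)

(** The number [e n] is the tail from [n] on of the geometric series that bounds the increments.
    Hence the intervals of center [u n] and radius [e n] are nested, and the supremum of their left
    ends is the limit. *)
Lemma geometric_limit (R : realType) (u : R^nat) (c : R) :
  (forall n, `|u n.+1 - u n| <= c * 2^-1 ^+ n) ->
  exists2 l, u @ \oo --> l & forall n, `|l - u n| <= c * 2^-1 ^+ n *+ 2.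
Proof.
move=> uc.
have c0 : 0 <= c by have := uc 0%N; rewrite expr0 mulr1; apply: le_trans.
pose e n := c * 2^-1 ^+ n *+ 2.
have e0 n : 0 <= e n by rewrite mulrn_wge0// mulr_ge0// exprn_ge0.
have eS n : e n.+1 = e n - c * 2^-1 ^+ n.
  by rewrite /e exprS -mulrnAr; field.
pose v n := u n - e n; pose w n := u n + e n.
have ndv : nondecreasing_seq v.
  apply/nondecreasing_seqP => n; rewrite /v eS.
  by have := uc n; rewrite ler_norml => /andP[+ _]; lra.
have niw : nonincreasing_seq w.
  apply/nonincreasing_seqP => n; rewrite /w eS.
  by have := uc n; rewrite ler_norml => /andP[_ +]; lra.
have vw m n : v m <= w n.
  apply: (@le_trans _ _ (v (maxn m n))); first by apply: ndv; exact: leq_maxl.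
  apply: (@le_trans _ _ (w (maxn m n))); last by apply: niw; exact: leq_maxr.
  by rewrite /v /w lerD2l; have := e0 (maxn m n); lra.
have l_le n : sup (range v) <= w n.
  by apply: ge_sup; [exists (v 0%N), 0%N|move=> _ [m _ <-]].
have le_l n : v n <= sup (range v).
  apply: ub_le_sup; last by exists n.
  by exists (w 0%N) => _ [m _ <-].
have lu n : `|sup (range v) - u n| <= e n.
  have := l_le n; have := le_l n; rewrite /v /w => a b.
  by rewrite ler_norml; apply/andP; split; lra.
exists (sup (range v)) => //.
have e_cvg : e n @[n --> \oo] --> 0.
  rewrite -(mul0rn R 2); apply: cvgMn.
  by apply: cvg_geometric; rewrite ger0_norm//; lra.
apply/cvgrPdist_le => /= eps eps0.
move/cvgrPdist_le : e_cvg => /(_ _ eps0); apply: filterS => n.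
by rewrite sub0r normrN; apply: le_trans; rewrite (ger0_norm (e0 n)).
Qed.

Lemma powRK (R : realType) (r a : R) : r != 0 -> 0 <= a -> (a `^ r) `^ r^-1 = a.
Proof. by move=> r0 a0; rewrite -powRrM divff// powRr1. Qed.

Lemma nneseries_le (R : realType) (u : (\bar R)^nat) (M : \bar R) :
  (forall n, 0 <= u n)%E -> (forall N, \sum_(0 <= n < N) u n <= M)%E ->
  (\sum_(0 <= n <oo) u n <= M)%E.
Proof.
move=> u0 uM; apply: lime_le; last by apply: nearW => N; exact: uM.
exact: is_cvg_nneseries.
Qed.

Lemma sum_half_powers (R : realType) N :
  \sum_(k < N) (2^-1 : R) ^+ k = 2 - 2 * 2^-1 ^+ N.
Proof.
elim: N => [|N IH]; first by rewrite big_ord0 expr0; lra.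
by rewrite big_ord_recr/= IH exprS; field.
Qed.

Section Lp_finite.
Context d (T : measurableType d) (R : realType).
Variables (mu : {measure set T -> \bar R}) (p : R) (p1 : (1 <= p%:E)%E).
Local Notation E := (Lp mu p1).
Local Notation F := (LfunType mu p1).

Let p_ge1 : 1 <= p. Proof. by rewrite -lee_fin. Qed.
Let p_gt0 : 0 < p. Proof. exact: lt_le_trans p_ge1. Qed.
Let p_neq0 : p != 0. Proof. by rewrite gt_eqF. Qed.

Lemma Lp_norm_powR (f : F) :
  ((`|Lp_class f| `^ p)%:E = \int[mu]_x (`|f x| `^ p)%:E)%E.
Proof.
rewrite -[`|_|]/(Lp_norm _) Lp_norm_class -poweR_EFin finite_norm_fine.
by rewrite poweR_Lnorm.
Qed.

Lemma Lfun_finP (f : T -> R) :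
  reflect (measurable_fun setT f /\ (\int[mu]_x (`|f x| `^ p)%:E < +oo)%E)
          (f \in Lfun mu p%:E).
Proof.
have -> : (f \in Lfun mu p%:E) =
    (f \in mfun) && (f \in finLfun mu p%:E) by [].
have fin : (f \in finLfun mu p%:E) <-> (\int[mu]_x (`|f x| `^ p)%:E < +oo)%E.
  rewrite inE /= /finite_norm; split => [|h].
    by move=> /(poweR_lty p); rewrite poweR_Lnorm.
  by apply: (lty_poweRy p_neq0); rewrite poweR_Lnorm.
apply: (iffP andP) => [[mf /fin h]|[mf h]]; split => //.
- by rewrite inE in mf.
- by rewrite inE.
- exact/fin.
Qed.

Lemma measurable_powR_norm (f : T -> R) : measurable_fun setT f ->
  measurable_fun setT (fun x => (`|f x| `^ p)%:E).
Proof.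
move=> mf; apply/measurable_EFinP.
apply: (measurableT_comp (measurable_powR p)).
exact: measurableT_comp.
Qed.

(* Writing [a n] for the p-th power of [2^n |f_(n+1) - f_n|], the sum of the [a n]
   is integrable, hence finite almost everywhere; there the increments are
   [O(2^-n)], and that sum dominates [|f - f_n|^p] up to a factor [2^(-n p)]. *)
Lemma Lp_fast_cauchy (u : nat -> E) :
  (forall n, `|u n.+1 - u n| <= 4^-1 ^+ n) ->
  exists l : E, u @ \oo --> l.
Proof.
move=> u4.
pose f n : F := Lp_repr (u n).
have uE n : u n = Lp_class (f n) by rewrite Lp_reprK.
pose a n x := (`|2 ^+ n * (f n.+1 x - f n x)| `^ p)%:E : \bar R.
have a0 n x : (0 <= a n x)%E by rewrite lee_fin powR_ge0.
have mfB m n : measurable_fun setT (fun x => f m x - f n x).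
  exact: measurable_funB.
have ma n : measurable_fun setT (a n).
  by apply: measurable_powR_norm; exact: measurable_funM.
pose H x := (\sum_(0 <= n <oo) a n x)%E.
have H0 x : (0 <= H x)%E by exact: nneseries_ge0.
have mH : measurable_fun setT H by exact: ge0_emeasurable_sum.
have intH : (\int[mu]_x H x < +oo)%E.
  rewrite integral_nneseries//.
  apply: (@le_lt_trans _ _ (\sum_(0 <= n <oo) (2^-1 ^+ n)%:E)%E).
    apply: lee_nneseries => n _ //; first by rewrite integral_ge0.
    have -> : (\int[mu]_x a n x =
        (`|Lp_class (2 ^+ n *: (f n.+1 - f n))| `^ p)%R%:E)%E.
      by rewrite Lp_norm_powR.
    rewrite lee_fin Lp_classZ Lp_classB -!uE normrZ.
    have le2 : `|2 ^+ n : R| * `|u n.+1 - u n| <= 2^-1 ^+ n.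
      rewrite ger0_norm ?exprn_ge0//.
      apply: (le_trans (ler_wpM2l _ (u4 n))); first exact: exprn_ge0.
      by rewrite -exprMn lerXn2r ?nnegrE//; lra.
    apply: (@le_trans _ _ ((2^-1 ^+ n) `^ p)).
      by apply: ge0_ler_powR; rewrite ?nnegrE ?mulr_ge0 ?exprn_ge0// ltW.
    apply: ge1r_powR => //; rewrite exprn_gt0 ?invr_gt0//=.
    by rewrite exprn_ile1 ?invr_ge0 ?invf_le1 ?ler1n.
  apply: (@le_lt_trans _ _ 2%:E); last exact: ltry.
  apply: nneseries_le => [n|N]; first by rewrite lee_fin exprn_ge0.
  rewrite sumEFin big_mkord sum_half_powers lee_fin lerBlDr lerDl mulr_ge0// exprn_ge0//.
have aeH : {ae mu, forall x, H x \is a fin_num}.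
  have : mu.-integrable setT H.
    apply/integrableP; split => //.
    by under eq_integral do rewrite gee0_abs//.
  move=> /(integrable_ae measurableT); apply: filterS => x; exact.
pose K := (\int[mu]_x H x)%E.
have K0 : (0 <= K)%E by exact: integral_ge0.
have Kfin : K \is a fin_num by rewrite ge0_fin_numE.
(* An upper limit is measurable on the whole space, and it is the limit of the [f n] wherever [H] is
   finite. *)
pose g x := fine (limn_esup (fun n => (f n x)%:E)).
have mg : measurable_fun setT g.
  apply: measurableT_comp => //; apply: measurable_fun_limn_esup => n.
  exact/measurable_EFinP.
have aeg : {ae mu, forall x, forall n,
    ((`|f n x - g x| `^ p)%:E <= ((2^-1 ^+ n *+ 2) `^ p)%:E * H x)%E}.
  apply: filterS aeH => x Hx n.
  have a_le m : (`|2 ^+ m * (f m.+1 x - f m x)| `^ p <= fine (H x)).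
    rewrite -lee_fin fineK//.
    apply: le_trans (nneseries_lim_ge m.+1 _) => //.
    by rewrite big_nat_recr//= leeDr// sume_ge0.
  have := @geometric_limit R (f ^~ x) (fine (H x) `^ p^-1).
  case=> [m|l fl lf].
    have := a_le m; rewrite normrM ger0_norm ?exprn_ge0// => am.
    rewrite exprVn ler_pdivlMr ?exprn_gt0// mulrC.
    rewrite -[leLHS](powRK p_neq0) ?mulr_ge0 ?exprn_ge0//.
    by rewrite ge0_ler_powR ?nnegrE ?powR_ge0 ?invr_ge0 ?(ltW p_gt0)// fine_ge0.
  have -> : g x = l.
    rewrite /g; have /cvg_limn_einf_sup[_ ->//] :
      (f n x)%:E @[n --> \oo] --> l%:E by apply: cvg_EFin; [exact: nearW|exact: fl].
  rewrite -[H x]fineK// -EFinM lee_fin distrC.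
  rewrite -[X in _ * X](@powRK _ p^-1) ?invr_neq0// ?fine_ge0// invrK.
  rewrite -powRM ?mulrn_wge0 ?exprn_ge0 ?powR_ge0//.
  rewrite ge0_ler_powR ?nnegrE ?(ltW p_gt0)//.
  - by rewrite mulr_ge0 ?mulrn_wge0 ?exprn_ge0 ?powR_ge0.
  - by apply: le_trans (lf n) _; rewrite mulrC mulrnAl.
have dist n : (\int[mu]_x (`|f n x - g x| `^ p)%:E <=
    ((2^-1 ^+ n *+ 2) `^ p)%:E * K)%E.
  rewrite /K -ge0_integralZl ?lee_fin ?powR_ge0//.
  apply: ae_ge0_le_integral => //.
  - by apply: measurable_powR_norm; exact: measurable_funB.
  - by move=> x _; rewrite mule_ge0// lee_fin powR_ge0.
  - exact: measurable_funeM.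
  - by apply: filterS aeg => x /(_ n) + _.
(* The bound at [n = 0] puts [f 0 - g], rather than [g] itself, in [L^p]; the limit is therefore
   written as [u 0] minus the class of that difference. *)
have hL : (fun x => f 0%N x - g x) \in Lfun mu p%:E.
  apply/Lfun_finP; split; first exact: measurable_funB.
  by apply: le_lt_trans (dist 0%N) _; rewrite -(fineK Kfin) -EFinM ltry.
pose h : F := Lfun_Sub p1 hL.
exists (u 0%N - Lp_class h).
have norm_le n : `|u 0%N - Lp_class h - u n| <= (2^-1 ^+ n *+ 2) * fine K `^ p^-1.
  have -> : u 0%N - Lp_class h - u n = - Lp_class (f n - (f 0%N - h)).
    by rewrite !Lp_classB -!uE opprB.
  rewrite normrN -[leLHS](powRK p_neq0)//.
  have e0 : 0 <= (2^-1 : R) ^+ n *+ 2 by rewrite mulrn_wge0 ?exprn_ge0.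
  rewrite -[X in X * _](powRK p_neq0)// -powRM ?powR_ge0 ?fine_ge0//.
  rewrite ge0_ler_powR ?nnegrE ?mulr_ge0 ?powR_ge0 ?fine_ge0//.
    by rewrite invr_ge0 ltW.
  rewrite -lee_fin EFinM fineK// Lp_norm_powR; apply: le_trans (dist n).
  rewrite le_eqVlt; apply/orP; left; apply/eqP.
  apply: eq_integral => x _; congr (`|_| `^ p)%:E.
  by rewrite -[LHS]/(f n x - (f 0%N x - (f 0%N x - g x))); ring.
apply/cvgrPdist_le => /= e e0.
have : (fine K `^ p^-1 *+ 2) * 2^-1 ^+ n @[n --> \oo] --> (0 : R).
  by apply: cvg_geometric; rewrite ger0_norm//; lra.
move=> /cvgrPdist_le /(_ _ e0); apply: filterS => n /= le_e.
apply: le_trans (norm_le n) (le_trans (ler_norm _) _).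
by apply: le_trans le_e; rewrite sub0r normrN mulrnAl mulrC mulrnAl.
Qed.

Lemma Lp_complete (u : nat -> E) :
  (forall e, 0 < e -> exists N, forall m n, (N <= m)%N -> (N <= n)%N ->
    `|u m - u n| <= e) ->
  exists l : E, u @ \oo --> l.
Proof.
move=> uC.
have N_ k : {N | forall m n, (N <= m)%N -> (N <= n)%N ->
    `|u m - u n| <= 4^-1 ^+ k}.
  by apply: cid; apply: uC; rewrite exprn_gt0 ?invr_gt0.
(* The sum makes [s] nondecreasing with [s k] at least [N_ k]; the summand [k] makes it exceed any
   given index, as the end of the proof requires. *)
pose s k := (k + \sum_(j < k.+1) sval (N_ j))%N.
have sN k : (sval (N_ k) <= s k)%N by rewrite /s big_ord_recr/=; lia.
have sS k : (s k <= s k.+1)%N by rewrite /s [in leqRHS]big_ord_recr/=; lia.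
have [|l sl] := @Lp_fast_cauchy (u \o s).
  move=> k /=; apply: (svalP (N_ k)) (sN k).
  exact: leq_trans (sN k) (sS k).
exists l; apply/cvgrPdist_le => /= e e0.
have e20 : 0 < e / 2 by rewrite divr_gt0.
have [N uN] := uC _ e20.
have [K _ lK] := (cvgrPdist_le _ _).1 sl _ e20.
exists N => //= n Nn; pose k := maxn K N.
have -> : l - u n = (l - u (s k)) + (u (s k) - u n) by rewrite addrA subrK.
rewrite (le_trans (ler_normD _ _))// [leRHS]splitr lerD//.
  by apply: lK; exact: leq_maxl.
by apply: uN => //; apply: leq_trans (leq_maxr K N) (leq_addr _ _).
Qed.

End Lp_finite.

Lemma continuous_borel_measurable (X Y : ptopologicalType) (f : X -> Y) :
  continuous f -> measurable_fun setT (f : borel X -> borel Y).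
Proof.
move=> /continuousP cf.
apply: (@measurability _ _ (borel X) (borel Y) setT f (@open Y)) => //.
move=> _ [B oB <-]; rewrite setTI; apply: sub_sigma_algebra; exact: cf.
Qed.

(** * Dyadic intervals of the unit interval and averages over them *)

Section dyadic.
Context (R : realType).
Local Notation I := (unit_interval R).
Local Notation leb := (@lebesgue01 R).

Lemma measurable_unit_val : measurable_fun setT (@unit_val R : borel I -> R).
Proof.
apply: (@measurability _ _ (borel I) R setT (@unit_val R) _
  (RGenOpens.measurableE R)).
move=> _ [_ [x [y ->]] <-]; rewrite setTI; apply: sub_sigma_algebra.
by exists `]x, y[%classic => //; exact: interval_open.
Qed.

Lemma unit_val_itv (t : I) : 0 <= unit_val t <= 1.
Proof. by have := set_valP t; rewrite /= in_itv. Qed.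

(* The endpoint 1 falls in an extra bin, number [2 ^ N], of measure 0. *)
Definition bin (N : nat) (t : I) : nat := Num.truncn (2 ^+ N * unit_val t).

Let bin_arg_ge0 N (t : I) : 0 <= 2 ^+ N * unit_val t.
Proof. by have /andP[] := unit_val_itv t => ? _; rewrite mulr_ge0 ?exprn_ge0. Qed.

Lemma bin_eq N (t : I) j :
  (bin N t == j) = (j%:R * 2^-1 ^+ N <= unit_val t < j.+1%:R * 2^-1 ^+ N).
Proof.
rewrite /bin truncn_eq// exprVn ler_pdivrMr ?ltr_pdivlMr ?exprn_gt0//.
by rewrite mulrC.
Qed.

Lemma bin_le N (t : I) : (bin N t <= 2 ^ N)%N.
Proof.
have /andP[_ t1] := unit_val_itv t.
rewrite /bin truncn_le_nat (@le_lt_trans _ _ (2 ^+ N))//.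
  by rewrite ler_piMr ?exprn_ge0.
by rewrite -natrX ltr_nat.
Qed.

Lemma bin_half N (t : I) : bin N t = (bin N.+1 t)./2.
Proof.
apply/eqP; rewrite bin_eq; have := bin_eq N.+1 t (bin N.+1 t).
rewrite eqxx; set j := bin N.+1 t => /esym/andP[jt tj].
have e0 : 0 < (2^-1 : R) ^+ N by rewrite exprn_gt0.
have jE : j%:R = (odd j)%:R + 2 * (j./2)%:R :> R.
  by rewrite -[in LHS](odd_double_half j) natrD -muln2 natrM mulrC.
move: jt tj; rewrite -[j.+1]addn1 -[(j./2).+1]addn1 !natrD jE exprS.
set e := 2^-1 ^+ N in e0 *; set h := (j./2)%:R => jt tj.
have [b0 b1] : (0 <= ((odd j)%:R : R)) /\ (((odd j)%:R : R) <= 1).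
  by case: (odd j); rewrite ?lexx ler01.
by apply/andP; split; nra.
Qed.

Lemma bin_div M N (t : I) : (M <= N)%N -> bin M t = (bin N t %/ 2 ^ (N - M))%N.
Proof.
move=> /subnKC <-; elim: (N - M)%N => [|k IH]; first by rewrite addn0 subnn divn1.
rewrite IH addnS bin_half -divn2 -divnMA -expnS; congr (_ %/ 2 ^ _)%N; lia.
Qed.

Lemma measurable_bin N j : measurable ([set t | bin N t = j] : set (borel I)).
Proof.
have -> : [set t | bin N t = j] = @unit_val R @^-1`
    `[j%:R * 2^-1 ^+ N, j.+1%:R * 2^-1 ^+ N[%classic.
  apply/seteqP; split => t /=; rewrite in_itv /=.
    by move=> /eqP; rewrite bin_eq.
  by rewrite -bin_eq => /eqP.
by rewrite -[X in measurable X]setTI; exact: measurable_unit_val.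
Qed.

Lemma lebesgue_bin N j : (j < 2 ^ N)%N ->
  leb [set t | bin N t = j] = (2^-1 ^+ N)%:E.
Proof.
move=> jN; rewrite /lebesgue01.
have e0 : 0 < (2^-1 : R) ^+ N by rewrite exprn_gt0.
have -> : @unit_val R @` [set t | bin N t = j] =
    `[j%:R * 2^-1 ^+ N, j.+1%:R * 2^-1 ^+ N[%classic.
  apply/seteqP; split => [_ [t <- <-]|x /=]; rewrite /= in_itv/=.
    by rewrite -bin_eq.
  move=> xj.
  have x01 : x \in (`[0, 1]%classic : set R).
    rewrite inE /= in_itv /=; move/andP : xj => [jx xj].
    rewrite (le_trans _ jx) ?mulr_ge0 ?(ltW e0)//=.
    apply: (le_trans (ltW xj)).
    by rewrite exprVn ler_pdivrMr ?exprn_gt0// mul1r -natrX ler_nat.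
  by exists (exist _ x x01) => //; apply/eqP; rewrite bin_eq.
rewrite lebesgue_measure_itv /= lte_fin ltr_pM2r// ltr_nat ltnS leqnn.
by rewrite -EFinD -mulrBl -natr1 addrAC subrr add0r mul1r.
Qed.

Lemma lebesgue_bin_max N : leb [set t | bin N t = (2 ^ N)%N] = 0%E.
Proof.
rewrite /lebesgue01.
have -> : @unit_val R @` [set t | bin N t = (2 ^ N)%N] = `[1, 1]%classic.
  apply/seteqP; split => [_ [t /eqP + <-]|x /=]; rewrite /= in_itv/=.
    rewrite bin_eq natrX -exprMn divff// expr1n => /andP[-> _].
    by have /andP[] := unit_val_itv t.
  move=> x1; have x01 : x \in (`[0, 1]%classic : set R).
    by move/andP : x1 => [/(le_trans ler01) x0 x1]; rewrite inE /= in_itv /= x0.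
  exists (exist _ x x01) => //; apply/eqP; rewrite bin_eq.
  have -> : unit_val (exist _ x x01) = 1 by apply/eqP; rewrite eq_le andbC.
  rewrite natrX -exprMn divff// expr1n lexx /= -natr1 mulrDl natrX -exprMn.
  by rewrite divff// expr1n ltrDl mul1r exprn_gt0.
by rewrite lebesgue_measure_itv /= ltxx.
Qed.

Lemma bin_sum N (Phi : nat -> R) (t : I) : Phi (bin N t) =
  \sum_(j < (2 ^ N).+1) Phi j * \1_[set t | bin N t = j] t.
Proof.
rewrite (bigD1 (inord (bin N t)))//= inordK ?ltnS ?bin_le//.
rewrite indicE mem_set// mulr1 big1 ?addr0// => i /eqP iN.
rewrite indicE memNset ?mulr0//= => tN; apply: iN; apply: val_inj => /=.
by rewrite inordK ?ltnS ?bin_le.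
Qed.

Lemma measurable_bin_fun N (Phi : nat -> R) :
  measurable_fun setT (fun t : borel I => Phi (bin N t)).
Proof.
under eq_fun do rewrite bin_sum.
apply: measurable_sum => j; apply: measurable_funM => //.
by apply: measurable_indic; exact: measurable_bin.
Qed.

Definition avg N (Phi : nat -> R) := 2^-1 ^+ N * \sum_(j < 2 ^ N) Phi j.

(** The bin number takes finitely many values, and the extra bin [2 ^ N], being null, drops out of
    the average. *)
Lemma integral_bin N (Phi : nat -> R) :
  (\int[leb]_t (Phi (bin N t))%:E = (avg N Phi)%:E)%E.
Proof.
under eq_integral do rewrite bin_sum -sumEFin.
have iI (j : nat) : leb.-integrable setT
    (fun t => (\1_[set t | bin N t = j] t)%:E).
  by apply: integrable_indic; exact: measurable_bin.
rewrite integral_sum//; last first.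
  by move=> j; under eq_fun do rewrite EFinM; exact: integrableZl.
under eq_bigr => j _.
  under eq_integral do rewrite EFinM.
  rewrite integralZl// integral_indic//; last exact: measurable_bin.
  rewrite setIT; over.
rewrite big_ord_recr /= [leb _]lebesgue_bin_max mule0 adde0 /avg mulr_sumr.
rewrite -sumEFin; apply: eq_bigr => j _.
by rewrite [leb _]lebesgue_bin// -EFinM mulrC.
Qed.

(** Bin [j] splits into the halves [j.*2] and [j.*2.+1]. Averaging over each pair of halves first is
    a conditional expectation, and it drives the inductions on the number of Rademacher terms. *)
Lemma avgS N Phi : avg N.+1 Phi = avg N (fun j => (Phi j.*2 + Phi j.*2.+1) / 2).
Proof.
rewrite /avg -mulr_suml exprSr -mulrA [X in _ * X]mulrC; congr (_ * (_ / _)).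
rewrite expnS mul2n; elim: (2 ^ N)%N => [|n IH]; first by rewrite !big_ord0.
by rewrite doubleS !big_ord_recr /= IH addrA.
Qed.

Lemma avg_ext N Phi Psi : (forall j, (j < 2 ^ N)%N -> Phi j = Psi j) ->
  avg N Phi = avg N Psi.
Proof. by move=> PP; congr (_ * _); apply: eq_bigr => j _; exact: PP. Qed.

Lemma avgZ N c Phi : avg N (fun j => c * Phi j) = c * avg N Phi.
Proof. by rewrite /avg -mulr_sumr mulrCA. Qed.

Lemma avgD N Phi Psi : avg N (fun j => Phi j + Psi j) = avg N Phi + avg N Psi.
Proof. by rewrite /avg big_split mulrDr. Qed.

Lemma avg_cst N c : avg N (fun _ => c) = c.
Proof.
rewrite /avg sumr_const card_ord -[X in _ * X]mulr_natl natrX mulrA -exprMn.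
by rewrite mulVf// expr1n mul1r.
Qed.

Lemma le_avg N Phi Psi : (forall j, Phi j <= Psi j) -> avg N Phi <= avg N Psi.
Proof. by move=> PP; rewrite ler_wpM2l ?exprn_ge0// ler_sum. Qed.

End dyadic.

(** * Rademacher functions and their finite sums *)

Section rademacher.
Context (R : realType).
Local Notation I := (unit_interval R).
Local Notation leb := (@lebesgue01 R).

(** The parity of [bin k.+1 t] is the binary digit of [t] in place [k.+1], for [t < 1]; at the
    endpoint 1 the bin number is even and the value is 1. *)
Definition rad (k : nat) (t : I) : R := (-1) ^+ bin k.+1 t.

Definition radsum (b : nat -> R) N (t : I) : R := \sum_(k < N) b k * rad k t.

(** All signs are read off the binary digits of the bin number [j]: the last digit gives the last
    sign, and [j./2] forgets it. *)
Fixpoint signsum (b : nat -> R) N (j : nat) : R :=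
  if N is N'.+1 then signsum b N' j./2 + b N' * (-1) ^+ j else 0.

Lemma signsumS b N j :
  signsum b N.+1 j = signsum b N j./2 + b N * (-1) ^+ j.
Proof. by []. Qed.

#[local] Arguments signsum : simpl never.

Lemma radsumE b N (t : I) : radsum b N t = signsum b N (bin N t).
Proof.
elim: N => [|N IH]; first by rewrite /radsum big_ord0.
by rewrite signsumS -bin_half -IH /radsum big_ord_recr.
Qed.

Lemma signsum_double b N j : signsum b N.+1 j.*2 = signsum b N j + b N.
Proof. by rewrite signsumS doubleK -signr_odd odd_double mulr1. Qed.

Lemma signsum_doubleS b N j : signsum b N.+1 j.*2.+1 = signsum b N j - b N.
Proof. by rewrite signsumS /= uphalf_double -signr_odd /= odd_double mulrN1. Qed.

Lemma measurable_rad k : measurable_fun setT (rad k : borel I -> R).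
Proof. exact: (measurable_bin_fun k.+1 (fun j => (-1) ^+ j)). Qed.

Lemma measurable_radsum b N : measurable_fun setT (radsum b N : borel I -> R).
Proof.
rewrite (_ : radsum b N = fun t => signsum b N (bin N t)).
  exact: measurable_bin_fun.
by apply/funext => t; exact: radsumE.
Qed.

(** Cross terms cancel between the two halves of a bin: the mean of [(s + c) ^ 2] and [(s - c) ^ 2]
    is [s ^ 2 + c ^ 2]. *)
Lemma integral_radsum_sqr b N :
  (\int[leb]_t (radsum b N t ^+ 2)%:E = (\sum_(k < N) b k ^+ 2)%:E)%E.
Proof.
under eq_integral do rewrite radsumE.
rewrite (integral_bin N (fun j => signsum b N j ^+ 2)); congr _%:E.
elim: N => [|N IH].
  by rewrite big_ord0 -[RHS](@avg_cst R 0); apply: avg_ext => j _ /=; rewrite expr0n.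
rewrite avgS big_ord_recr /= -IH -[b N ^+ 2](avg_cst N) -avgD.
apply: avg_ext => j _; rewrite signsum_double signsum_doubleS.
by field.
Qed.

(* With [x = b^2]: if [x <= 1/2] then [cosh b <= 1 / (1 - x) <= 1 + 2 x], and
   otherwise [|b| <= 2 x]. *)
Lemma cosh_le (b : R) : (expR b + expR (- b)) / 2 <= expR (2 * b ^+ 2).
Proof.
have eb := expR_gt0 b; have eNb := expR_gt0 (- b).
have e1 := expRxMexpNx_1 b.
have ge1 (x : R) : 1 + x <= expR x by exact: expR_ge1Dx.
have [b2|b2] := leP (b ^+ 2) 2^-1; last first.
  have bb : `|b| <= 2 * b ^+ 2.
    by rewrite -real_normK ?num_real// in b2 *; have := normr_ge0 b; nra.
  apply: (@le_trans _ _ (expR `|b|)); last by rewrite ler_expR.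
  have h1 : expR b <= expR `|b| by rewrite ler_expR ler_norm.
  have h2 : expR (- b) <= expR `|b| by rewrite ler_expR -normrN ler_norm.
  lra.
apply: le_trans (ge1 _).
have h1 := ge1 b; have h2 := ge1 (- b).
have b1 : `|b| < 1.
  by rewrite -(@ltr_pXn2r _ 2)// ?nnegrE// expr1n real_normK ?num_real//; lra.
move: b1; rewrite ltr_norml => /andP[bl br].
have u1 : expR b * (1 - b) <= 1 by nra.
have u2 : expR (- b) * (1 + b) <= 1 by nra.
have u3 : (expR b + expR (- b)) * (1 - b ^+ 2) <= 2 by nra.
have : (expR b + expR (- b)) * (1 - b ^+ 2) <= (2 * (1 + 2 * b ^+ 2)) * (1 - b ^+ 2).
  apply: (le_trans u3); have := sqr_ge0 b; nra.
rewrite ler_pM2r; lra.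
Qed.

(** Averaging over the two halves of a bin turns the last term into a factor [cosh (b N)], and
    [cosh_le] makes the product of these factors an exponential of the sum of squares. *)
Lemma integral_radsum_exp b N :
  (\int[leb]_t (expR (radsum b N t))%:E <= (expR (2 * \sum_(k < N) b k ^+ 2))%:E)%E.
Proof.
under eq_integral do rewrite radsumE.
rewrite (integral_bin N (fun j => expR (signsum b N j))) lee_fin.
elim: N => [|N IH].
  by rewrite /avg expr0 mul1r expn0 big_ord1 big_ord0 mulr0.
rewrite avgS big_ord_recr /= mulrDr expRD.
apply: (@le_trans _ _ (expR (2 * b N ^+ 2) * avg N (fun j => expR (signsum b N j)))).
  rewrite -avgZ; apply: le_avg => j; rewrite signsum_double signsum_doubleS.
  rewrite !expRD -mulrDr mulrAC -mulrA [leRHS]mulrC ler_wpM2l ?expR_ge0//.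
  by have := cosh_le (b N); rewrite mulrC.
by rewrite mulrC ler_wpM2r ?expR_ge0.
Qed.

(** By induction on [N]. A term of index above [k] changes sign between the halves of a bin and
    averages out. When [k] is the last index, the halves contribute [s + b k] and [- (s - b k)],
    with mean [b k], and the measure of bin [i] remains. The condition [m <= k] makes both halves
    lie in the same bin of generation [m]. *)
Lemma integral_radsum_rad b N m k i : (i < 2 ^ m)%N -> (m <= k)%N -> (k < N)%N ->
  (\int[leb]_t ((bin m t == i)%:R * radsum b N t * rad k t)%:E =
   (b k * 2^-1 ^+ m)%:E)%E.
Proof.
move=> im mk; elim: N => // N IH; rewrite ltnS leq_eqVlt => /predU1P[kE|kN].
  pose Phi j : R := (j./2 %/ 2 ^ (N - m) == i)%N%:R * signsum b N.+1 j * (-1) ^+ j.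
  have NN : (m <= N)%N by rewrite -kE.
  rewrite kE.
  rewrite (eq_integral (fun t : borel I => (Phi (bin N.+1 t))%:E)); last first.
    move=> t _; rewrite /Phi radsumE -bin_half /rad.
    by rewrite (bin_div _ NN).
  rewrite integral_bin; congr _%:E.
  transitivity (b N * avg N (fun j => (j %/ 2 ^ (N - m) == i)%N%:R)).
    rewrite avgS -avgZ; apply: avg_ext => j _; rewrite /Phi.
    rewrite signsum_double signsum_doubleS doubleK (uphalf_double j : (_.+1)./2 = _).
    rewrite -[_ ^+ j.*2]signr_odd -[_ ^+ j.*2.+1]signr_odd /= odd_double /=.
    by rewrite expr1 expr0; field.
  congr (_ * _); apply: EFin_inj; rewrite -integral_bin -(lebesgue_bin R im).
  rewrite -[X in leb X]setIT -integral_indic//; last exact: measurable_bin.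
  apply: eq_integral => t _; rewrite -(bin_div _ NN) indicE.
  rewrite (_ : t \in _ = (bin m t == i)) ?in_setE//.
  by apply/idP/eqP; rewrite in_setE.
have mN : (m <= N)%N by lia.
rewrite -(IH kN).
pose Psi j : R := (j %/ 2 ^ (N - m) == i)%N%:R * signsum b N j *
  (-1) ^+ (j %/ 2 ^ (N - k.+1)).
pose Phi j : R := (j./2 %/ 2 ^ (N - m) == i)%N%:R * signsum b N.+1 j *
  (-1) ^+ (j./2 %/ 2 ^ (N - k.+1)).
rewrite (eq_integral (fun t : borel I => (Phi (bin N.+1 t))%:E)); last first.
  move=> t _; rewrite /Phi radsumE -bin_half /rad.
  by rewrite (bin_div _ mN) (bin_div _ kN).
rewrite [RHS](eq_integral (fun t : borel I => (Psi (bin N t))%:E)); last first.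
  by move=> t _; rewrite /Psi radsumE /rad (bin_div _ mN) (bin_div _ kN).
rewrite !integral_bin avgS; congr _%:E; apply: avg_ext => j _.
rewrite /Phi /Psi signsum_double signsum_doubleS doubleK (uphalf_double j : (_.+1)./2 = _).
by field.
Qed.

End rademacher.

(** * Khinchine's inequality as moment bounds *)

Section khinchine.
Context (R : realType).
Local Notation I := (unit_interval R).
Local Notation leb := (@lebesgue01 R).
Implicit Types (b : nat -> R) (p : R).

(** This is the p-th power of [z <= expR z] at [z = |y| / p]. Two exponentials replace that of [|y|]
    because each of them is the exponential of a Rademacher sum when [y] is one. *)
Lemma powR_le_exp p (y : R) : 0 < p -> `|y| `^ p <= p `^ p * (expR y + expR (- y)).
Proof.
move=> p0.
have h : `|y| <= p * expR (`|y| / p).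
  rewrite mulrC -ler_pdivrMr//.
  by apply: le_trans (expR_ge1Dx _); rewrite lerDr.
apply: (@le_trans _ _ ((p * expR (`|y| / p)) `^ p)).
  by rewrite ge0_ler_powR ?nnegrE ?mulr_ge0 ?expR_ge0// ltW.
rewrite powRM ?expR_ge0 ?(ltW p0)// -expRM mulfVK ?gt_eqF//.
rewrite ler_wpM2l ?powR_ge0//.
by case: (ger0P y) => _; rewrite ?lerDl ?lerDr expR_ge0.
Qed.

(* The three terms account for [|y| <= 1/2], [1/4 < y^2 <= M] and [M < y^2]; the
   last one lets the fourth moment control the large values of a Rademacher sum. *)
Lemma sqr_le_powR p (M y : R) : 0 < p -> 0 < M ->
  y ^+ 2 <= 4^-1 + M * 2 `^ p * `|y| `^ p + M^-1 * `|y| `^ 4%:R.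
Proof.
move=> p0 M0; rewrite -mulrA -powRM// powR_mulrn//.
rewrite -(real_normK (num_real y)); set z := `|y|.
have z0 : 0 <= z by exact: normr_ge0.
have a0 : 0 <= (2 * z) `^ p by exact: powR_ge0.
have M10 : 0 < M^-1 by rewrite invr_gt0.
have [z2|z2] := leP z 2^-1.
  have : 0 <= M^-1 * z ^+ 4 by rewrite mulr_ge0 ?exprn_ge0// ltW.
  have : 0 <= M * (2 * z) `^ p by rewrite mulr_ge0// ltW.
  by rewrite expr2; nra.
have a1 : 1 <= (2 * z) `^ p.
  have : (2 * z) `^ 0 <= (2 * z) `^ p by rewrite ler_powR ?(ltW p0)//; lra.
  by rewrite powRr0.
have [zM|Mz] := leP (z ^+ 2) M.
  have : 0 <= M^-1 * z ^+ 4 by rewrite mulr_ge0 ?exprn_ge0// ltW.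
  by nra.
have : z ^+ 2 <= M^-1 * z ^+ 4.
  by rewrite mulrC ler_pdivlMr// (exprD z 2 2) ler_wpM2l ?sqr_ge0// ltW.
have : 0 <= M * (2 * z) `^ p by rewrite mulr_ge0// ltW.
by lra.
Qed.

(** For coefficients with square sum at most 1, the exponential moments of the sum and of its
    opposite are each at most [expR 2]. *)
Let C p := p `^ p * (expR 2 *+ 2).

Let measurable_pow p b N :
  measurable_fun setT (fun t : borel I => (`|radsum b N t| `^ p)%:E).
Proof. by apply: measurable_powR_norm; exact: measurable_radsum. Qed.

Lemma integral_radsum_powR_le p b N : 0 < p -> \sum_(k < N) b k ^+ 2 <= 1 ->
  (\int[leb]_t (`|radsum b N t| `^ p)%:E <= (C p)%:E)%E.
Proof.
move=> p0 b1.
have mexp b' : measurable_fun setT (fun t : borel I => (expR (radsum b' N t))%:E).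
  apply/measurable_EFinP; apply: measurableT_comp => //.
  exact: measurable_radsum.
have radN (t : I) : - radsum b N t = radsum (fun k => - b k) N t.
  by rewrite /radsum -sumrN; apply: eq_bigr => k _; rewrite mulNr.
apply: (@le_trans _ _ (\int[leb]_t ((p `^ p)%:E *
    ((expR (radsum b N t))%:E + (expR (radsum (fun k => - b k) N t))%:E))))%E.
  apply: ge0_le_integral => //.
  - by apply: measurable_funeM; apply: emeasurable_funD.
  - by move=> t _; rewrite -EFinD -EFinM lee_fin -radN powR_le_exp.
rewrite ge0_integralZl ?lee_fin ?powR_ge0//; last 2 first.
- exact: emeasurable_funD (mexp _) (mexp _).
- by move=> t _; rewrite -EFinD lee_fin addr_ge0 ?expR_ge0.
rewrite ge0_integralD//.
rewrite /C EFinM lee_wpmul2l ?lee_fin ?powR_ge0// mulr2n EFinD leeD//.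
  apply: (le_trans (integral_radsum_exp _ _)); rewrite lee_fin ler_expR; lra.
apply: (le_trans (integral_radsum_exp _ _)); rewrite lee_fin ler_expR.
by under eq_bigr do rewrite sqrrN; lra.
Qed.

(** With second moment 1 and a bounded fourth moment, the mass cannot all sit at small or at very
    large values, so the p-th moment stays away from 0. *)
Lemma integral_radsum_powR_ge p : 0 < p -> exists2 c, 0 < c &
  forall b N, \sum_(k < N) b k ^+ 2 = 1 ->
  (c%:E <= \int[leb]_t (`|radsum b N t| `^ p)%:E)%E.
Proof.
(* This [M] brings the fourth-moment term of [sqr_le_powR] down to 1/4. With the constant 1/4, half
   of the second moment is left for the p-th power term, whence the constant below. *)
move=> p0; pose M := 4 * C 4.
have C0 : 0 < C 4 by rewrite mulr_gt0 ?powR_gt0// pmulrn_lgt0 ?expR_gt0.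
have M0 : 0 < M by rewrite mulr_gt0.
have P0 : 0 < M * 2 `^ p by rewrite mulr_gt0 ?powR_gt0.
exists ((M * 2 `^ p)^-1 / 2); first by rewrite mulr_gt0 ?invr_gt0.
move=> b N b1.
have mp := measurable_pow.
have := integral_radsum_sqr b N; rewrite b1 => int1.
have : (\int[leb]_t (radsum b N t ^+ 2)%:E <= \int[leb]_t
    ((4^-1)%:E + ((M * 2 `^ p)%:E * (`|radsum b N t| `^ p)%:E +
    (M^-1)%:E * (`|radsum b N t| `^ 4)%:E)))%E.
  apply: ge0_le_integral => //.
  - by move=> t _; rewrite lee_fin sqr_ge0.
  - by apply/measurable_EFinP; apply: measurable_funX; exact: measurable_radsum.
  - apply: emeasurable_funD => //; apply: emeasurable_funD; exact: measurable_funeM.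
  - by move=> t _; rewrite -!EFinM -!EFinD lee_fin addrA sqr_le_powR.
rewrite int1 ge0_integralD//; last 2 first.
- by move=> t _; rewrite -!EFinM -!EFinD lee_fin addr_ge0 ?mulr_ge0 ?powR_ge0// ?invr_ge0 ltW.
- by apply: emeasurable_funD; exact: measurable_funeM.
rewrite ge0_integralD//; last 4 first.
- by move=> t _; rewrite -!EFinM lee_fin mulr_ge0 ?powR_ge0// ltW.
- exact: measurable_funeM.
- by move=> t _; rewrite -!EFinM lee_fin mulr_ge0 ?powR_ge0// invr_ge0 ltW.
- exact: measurable_funeM.
rewrite ge0_integralZl ?lee_fin ?(ltW P0)//.
rewrite ge0_integralZl ?lee_fin ?invr_ge0 ?(ltW M0)//.
rewrite (_ : \int[leb]_x (4^-1)%:E = (4^-1)%:E)%E; last first.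
  rewrite integral_cst// -[RHS]mule1; congr (_ * _)%E.
  exact: (@probability_setT _ _ _ (@lebesgue01 R)).
have p40 : 0 < (4 : R) by [].
have b1_le : \sum_(k < N) b k ^+ 2 <= 1 by rewrite b1.
have := integral_radsum_powR_le p40 b1_le.
have : (0 <= \int[leb]_t (`|radsum b N t| `^ 4)%:E)%E.
  by apply: integral_ge0 => t _; rewrite lee_fin powR_ge0.
case: (\int[leb]_t (`|radsum b N t| `^ 4)%:E)%E => // z; rewrite !lee_fin => z0 zC.
have : (0 <= \int[leb]_t (`|radsum b N t| `^ p)%:E)%E.
  by apply: integral_ge0 => t _; rewrite lee_fin powR_ge0.
case: (\int[leb]_t (`|radsum b N t| `^ p)%:E)%E => [w||//]; last by move=> *; rewrite leey.
rewrite lee_fin => w0.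
rewrite -!EFinM -!EFinD !lee_fin => h.
rewrite ler_pdivrMr// -(ler_pM2l P0) mulfV ?gt_eqF//.
have : M^-1 * z <= 4^-1 by rewrite mulrC ler_pdivrMr// /M; lra.
lra.
Qed.

End khinchine.

(** * Rademacher series in [L^p([0,1])] *)

Section rademacher_series.
Context (R : realType) (p : R) (p1 : (1 <= p%:E)%E).
Local Notation I := (unit_interval R).
Local Notation leb := (@lebesgue01 R).
Local Notation E := (Lp leb p1).
Implicit Types b : nat -> R.

Let p_ge1 : 1 <= p. Proof. by rewrite -lee_fin. Qed.
Let p_gt0 : 0 < p. Proof. exact: lt_le_trans p_ge1. Qed.
Let p_neq0 : p != 0. Proof. by rewrite gt_eqF. Qed.

Lemma rad_Lfun k : (rad k : borel I -> R) \in Lfun leb p%:E.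
Proof.
apply/(Lfun_finP _ p1); split; first exact: measurable_rad.
rewrite (eq_integral (cst 1%E)); last first.
  by move=> t _; rewrite /rad normrX normrN1 expr1n powR1.
rewrite integral_cst// mul1e; apply: le_lt_trans (probability_le1 leb _) (ltry _).
exact: measurableT.
Qed.

Definition Rad k : E := Lp_class (Lfun_Sub p1 (rad_Lfun k)).

Definition Radsum b N : E := \sum_(k < N) b k *: Rad k.

Lemma RadsumE b N :
  exists2 f : LfunType leb p1, (f : I -> R) =1 radsum b N & Radsum b N = Lp_class f.
Proof.
elim: N => [|N [f fE SE]].
  exists 0; first by move=> t; rewrite /radsum big_ord0.
  rewrite /Radsum big_ord0; apply/(addIr (Lp_class 0)).
  by rewrite -Lp_classD add0r addr0.
exists (f + b N *: Lfun_Sub p1 (rad_Lfun N)).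
  by move=> t; rewrite /radsum big_ord_recr -[RHS]/(radsum b N t + _) -fE.
by rewrite /Radsum big_ord_recr -[LHS]/(Radsum b N + _) SE Lp_classD Lp_classZ.
Qed.

Lemma RadsumD b1 b2 N :
  Radsum (fun k => b1 k + b2 k) N = Radsum b1 N + Radsum b2 N.
Proof. by rewrite -big_split; apply: eq_bigr => k _; rewrite scalerDl. Qed.

Lemma RadsumZ a b N : Radsum (fun k => a * b k) N = a *: Radsum b N.
Proof. by rewrite scaler_sumr; apply: eq_bigr => k _; rewrite scalerA. Qed.

Definition sqsum b N : R := \sum_(k < N) b k ^+ 2.

Lemma sqsum_ge0 b N : 0 <= sqsum b N.
Proof. by apply: sumr_ge0 => k _; exact: sqr_ge0. Qed.

Lemma sqsum_nd b : nondecreasing_seq (sqsum b).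
Proof.
apply/nondecreasing_seqP => n.
by rewrite {2}/sqsum big_ord_recr /= lerDl sqr_ge0.
Qed.

Lemma norm_Radsum b N :
  ((`|Radsum b N| `^ p)%:E = \int[leb]_t (`|radsum b N t| `^ p)%:E)%E.
Proof.
have [f fE ->] := RadsumE b N.
by rewrite Lp_norm_powR; under eq_integral do rewrite fE.
Qed.

Lemma khinchine : exists c C : R, [/\ 0 < c, 0 < C &
  forall b N, c * Num.sqrt (sqsum b N) <= `|Radsum b N|
           /\ `|Radsum b N| <= C * Num.sqrt (sqsum b N)].
Proof.
have [c c0 cP] := integral_radsum_powR_ge p_gt0.
pose K := p `^ p * (expR 2 *+ 2) : R.
have K0 : 0 < K by rewrite mulr_gt0 ?powR_gt0// pmulrn_lgt0 ?expR_gt0.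
have pV : 0 <= p^-1 by rewrite invr_ge0 ltW.
exists (c `^ p^-1), (K `^ p^-1); split; rewrite ?powR_gt0// => b N.
have [s0|s0] := eqVneq (sqsum b N) 0.
  rewrite s0 sqrtr0 !mulr0; split=> //.
  suff -> : Radsum b N = 0 by rewrite normr0.
  rewrite /Radsum big1// => k _.
  have /eqP := s0; rewrite psumr_eq0 => [|j _]; last exact: sqr_ge0.
  by move=> /allP/(_ k); rewrite mem_index_enum sqrf_eq0 => /(_ isT)/eqP ->; rewrite scale0r.
set s := Num.sqrt (sqsum b N).
have ss : s ^+ 2 = sqsum b N by rewrite sqr_sqrtr ?sqsum_ge0.
have s_gt0 : 0 < s by rewrite sqrtr_gt0 lt0r s0 sqsum_ge0.
pose b' k := s^-1 * b k.
have b'1 : \sum_(k < N) b' k ^+ 2 = 1.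
  under eq_bigr do rewrite exprMn.
  by rewrite -mulr_sumr -/(sqsum b N) -ss -exprMn mulVf ?gt_eqF// expr1n.
have b'1_le : \sum_(k < N) b' k ^+ 2 <= 1 by rewrite b'1.
have lo := cP _ _ b'1; have hi := integral_radsum_powR_le p_gt0 b'1_le.
rewrite -norm_Radsum lee_fin in lo; rewrite -norm_Radsum lee_fin in hi.
have -> : Radsum b N = s *: Radsum b' N.
  by rewrite RadsumZ scalerA mulfV ?gt_eqF// scale1r.
rewrite normrZ gtr0_norm// [_ * s]mulrC [K `^ _ * s]mulrC !ler_pM2l//.
rewrite -(powRK p_neq0 (normr_ge0 (Radsum b' N))).
by split; rewrite ge0_ler_powR ?nnegrE ?powR_ge0// ltW.
Qed.

Definition square_summable b := exists M, forall N, sqsum b N <= M.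

(** [lim] has a default value on divergent sequences, so this is the sum of the series only for
    coefficients such as the square-summable ones. *)
Definition Radlim b : E := lim (Radsum b N @[N --> \oo]).

Lemma Radsum_cvg b : square_summable b -> Radsum b N @[N --> \oo] --> Radlim b.
Proof.
move=> [M bM]; suff [l] : exists l : E, Radsum b N @[N --> \oo] --> l.
  by move=> /cvgP.
have [c [C [_ C0 kh]]] := khinchine.
have sc : cvgn (sqsum b).
  apply: nondecreasing_is_cvgn; first exact: sqsum_nd.
  by exists M => _ [N _ <-].
pose S := limn (sqsum b).
have sS N : sqsum b N <= S by apply: nondecreasing_cvgn_le => //; exact: sqsum_nd.
apply: Lp_complete => e e0.
(* Khinchine's upper bound, applied to the coefficients with the first [m] set to 0, turns a tail of
   squares at most [(e / C) ^+ 2] into a distance at most [e]. *)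
have eC : 0 < (e / C) ^+ 2 by rewrite exprn_gt0 ?divr_gt0.
have [N _ NP] := (cvgrPdist_le _ _).1 sc _ eC.
have main m n : (N <= m)%N -> (m <= n)%N -> `|Radsum b n - Radsum b m| <= e.
  move=> Nm mn; pose b' k := if (k < m)%N then 0 else b k.
  have split (V : zmodType) (F G : nat -> V) :
      (forall k, G k = if (k < m)%N then 0 else F k) ->
      \sum_(k < n) F k - \sum_(k < m) F k = \sum_(k < n) G k.
    move=> GF; rewrite -(subnKC mn) !big_split_ord /=.
    rewrite [X in _ = X + _]big1 ?add0r => [|k _]; last by rewrite GF ltn_ord.
    rewrite addrAC subrr add0r; apply: eq_bigr => k _.
    by rewrite GF ltnNge leq_addr.
  have -> : Radsum b n - Radsum b m = Radsum b' n.
    rewrite /Radsum (@split E (fun k => b k *: Rad k) (fun k => b' k *: Rad k))// => k.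
    by rewrite /b'; case: ifP; rewrite ?scale0r.
  have /(le_trans (kh b' n).2) : C * Num.sqrt (sqsum b' n) <= e; last exact.
  have eC0 : 0 <= e / C by rewrite divr_ge0 ?ltW.
  rewrite mulrC -ler_pdivlMr// -[leRHS](ger0_norm eC0) -sqrtr_sqr.
  rewrite ler_sqrt ?sqr_ge0//.
  have -> : sqsum b' n = sqsum b n - sqsum b m.
    rewrite /sqsum (@split R (fun k => b k ^+ 2) (fun k => b' k ^+ 2))// => k.
    by rewrite /b'; case: ifP; rewrite ?expr0n.
  have /= := NP m Nm; rewrite ger0_norm ?subr_ge0//.
  by apply: le_trans; rewrite lerD2r.
exists N => m n Nm Nn; have [mn|/ltnW nm] := leqP m n.
  by rewrite distrC main.
by rewrite main.
Qed.

Lemma RadlimD b1 b2 : square_summable b1 -> square_summable b2 ->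
  Radlim (fun k => b1 k + b2 k) = Radlim b1 + Radlim b2.
Proof.
move=> /Radsum_cvg c1 /Radsum_cvg c2; apply/cvg_lim => //.
by under eq_fun do rewrite RadsumD; exact: cvgD.
Qed.

Lemma RadlimZ a b : square_summable b ->
  Radlim (fun k => a * b k) = a *: Radlim b.
Proof.
move=> /Radsum_cvg c1; apply/cvg_lim => //.
by under eq_fun do rewrite RadsumZ; exact: cvgZr.
Qed.

Lemma Radlim_bounds : exists c C : R, [/\ 0 < c, 0 < C &
  forall b, square_summable b ->
    (forall N, c * Num.sqrt (sqsum b N) <= `|Radlim b|) /\
    (forall M, 0 <= M -> (forall N, sqsum b N <= M ^+ 2) -> `|Radlim b| <= C * M)].
Proof.
have [c [C [c0 C0 kh]]] := khinchine.
exists c, C; split => // b sb.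
have cb : `|Radsum b N| @[N --> \oo] --> `|Radlim b|.
  by apply: cvg_norm; exact: Radsum_cvg.
split=> [N|M M0 bM].
  rewrite -(cvg_lim (@Rhausdorff R) cb); apply: limr_ge; first exact: cvgP cb.
  near=> n; apply: le_trans (kh b n).1.
  rewrite ler_pM2l// ler_sqrt ?sqsum_ge0//; apply: sqsum_nd.
  by near: n; exact: nbhs_infty_ge.
rewrite -(cvg_lim (@Rhausdorff R) cb); apply: limr_le; first exact: cvgP cb.
apply: nearW => n; apply: le_trans (kh b n).2 _.
rewrite ler_pM2l// -[leRHS](ger0_norm M0) -sqrtr_sqr ler_sqrt ?sqr_ge0//.
Unshelve. all: by end_near. Qed.

(** Integrate [y <= 1 + y ^ p] at [y = lambda * |h|] over a space of mass 1. This elementary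
    substitute for Hölder's inequality costs only the factor 2. *)
Lemma integral_abs_le (h : LfunType leb p1) (lambda : R) : 0 < lambda ->
  `|Lp_class h| <= lambda^-1 ->
  (\int[leb]_t `|(h t)%:E| <= (lambda^-1 *+ 2)%:E)%E.
Proof.
move=> l0 hl.
have mh : measurable_fun setT (h : borel I -> R) by [].
have : (\int[leb]_t (lambda%:E * `|(h t)%:E|) <=
    \int[leb]_t (1%:E + (lambda `^ p)%:E * (`|h t| `^ p)%:E))%E.
  apply: ge0_le_integral => //.
  - by move=> t _; rewrite -EFinM lee_fin mulr_ge0// ltW.
  - by apply: measurable_funeM; apply: measurableT_comp => //; exact/measurable_EFinP.
  - apply: emeasurable_funD => //; apply: measurable_funeM.
    exact: measurable_powR_norm.
  - move=> t _; rewrite -EFinM -EFinM -EFinD lee_fin -powRM ?(ltW l0)//.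
    set y := lambda * `|h t|; have y0 : 0 <= y by rewrite mulr_ge0// ltW.
    have [y1|/ltW y1] := leP y 1; first by rewrite (le_trans y1)// lerDl powR_ge0.
    by rewrite (le_trans (le1r_powR y1 p_ge1))// lerDr.
rewrite ge0_integralZl ?lee_fin ?(ltW l0)//; last first.
  by apply: measurableT_comp => //; exact/measurable_EFinP.
rewrite ge0_integralD//; last 2 first.
- by move=> t _; rewrite -EFinM lee_fin mulr_ge0 ?powR_ge0.
- by apply: measurable_funeM; exact: measurable_powR_norm.
rewrite ge0_integralZl ?lee_fin ?powR_ge0//; last exact: measurable_powR_norm.
rewrite -Lp_norm_powR (_ : \int[leb]_x 1%:E = 1%:E)%E; last first.
  rewrite integral_cst// -[RHS]mule1; congr (_ * _)%E.
  exact: (@probability_setT _ _ _ (@lebesgue01 R)).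
move=> le1.
have le2 : (lambda%:E * \int[leb]_t `|(h t)%:E| <= 2%:E)%E.
  apply: (le_trans le1); rewrite -EFinM -EFinD lee_fin -powRM ?(ltW l0)//.
  have one : (1 : R) `^ p = 1 by rewrite powR1.
  rewrite -[leRHS]/(1 + 1) lerD2l -[leRHS]one ge0_ler_powR ?nnegrE ?(ltW p_gt0)//.
    by rewrite mulr_ge0 ?(ltW l0).
  by rewrite mulrC -ler_pdivlMr// div1r.
by rewrite -mulr_natr EFinM lee_pdivlMl.
Qed.

(** Pairing a partial sum of length above [k] with [r_k] on bin [i] gives [b k * 2^-1 ^+ m],
    whatever the length. Since [f] vanishes there, the same pairing is bounded by the [L^1] distance
    from the partial sum to [f], which is as small as desired. *)
Lemma Radlim_coef_eq0 b (f : LfunType leb p1) m i : square_summable b ->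
  Radlim b = Lp_class f -> (i < 2 ^ m)%N ->
  {ae leb, forall t, bin m t = i -> f t = 0} ->
  forall k, (m <= k)%N -> b k = 0.
Proof.
move=> sb bf im f0 k mk; apply/eqP; rewrite -normr_le0.
have e0 : 0 < (2^-1 : R) ^+ m by rewrite exprn_gt0.
apply/ler_addgt0Pr => e e_gt0; rewrite add0r.
(* The doubled bound of [integral_abs_le] is then [e * 2^-1 ^+ m], and the measure of the bin
   cancels. *)
pose lambda := (e * 2^-1 ^+ m / 2)^-1.
have l0 : 0 < lambda by rewrite invr_gt0 !mulr_gt0.
have [N [kN Nl]] : exists N, (k < N)%N /\ `|Radlim b - Radsum b N| <= lambda^-1.
  have [N _ NP] := (cvgrPdist_le _ _).1 (Radsum_cvg sb) lambda^-1 ltac:(by rewrite invr_gt0).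
  exists (maxn N k.+1); split; first exact: leq_maxr.
  by apply: NP; exact: leq_maxl.
have [g gE gS] := RadsumE b N.
rewrite bf gS -Lp_classB in Nl.
have := integral_abs_le l0 Nl.
rewrite -(ler_pM2r e0) -lee_fin => hl.
have := integral_radsum_rad b im mk kN => bk.
have -> : (`|b k| * 2^-1 ^+ m)%:E = `|(b k * 2^-1 ^+ m)%:E|%E.
  by rewrite /= normrM (gtr0_norm e0).
rewrite -bk.
have mrs := measurable_radsum b N.
have mint : measurable_fun setT (fun t : borel I =>
    ((bin m t == i)%:R * radsum b N t * rad k t)%:E).
  apply/measurable_EFinP; apply: measurable_funM; last exact: measurable_rad.
  apply: measurable_funM => //.
  exact: (@measurable_bin_fun R m (fun j => (j == i)%:R)).
apply: (le_trans (le_abse_integral _ _ _)) => //.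
apply: (@le_trans _ _ (\int[leb]_t `|((f - g : LfunType leb p1) t)%:E|)%E); last first.
  apply: (le_trans hl); rewrite /lambda invrK lee_fin; lra.
apply: ae_ge0_le_integral => //.
- exact: measurableT_comp.
- by apply: measurableT_comp => //; exact/measurable_EFinP.
apply: (@filterS _ _ (ae_filter_ringOfSetsType leb) _ _ _ f0) => t ft _.
rewrite /= lee_fin -[X in _ <= `|X|]/(f t - g t) gE normrM /rad normrX normrN1 expr1n mulr1.
case: eqP => [/ft ->|_]; first by rewrite mul1r sub0r normrN.
by rewrite mul0r normr0.
Qed.

End rademacher_series.

(** * Coordinates in [l^2] and the spreading of sequences *)

Section ell2.
Context (R : realType).
Local Notation l2 := (ell2 R).
Implicit Types (x y : l2).

Definition coord x (n : nat) : R := Lp_repr x n.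

(** A null set for the counting measure is empty, each singleton having measure 1; hence [coord]
    does not depend on the chosen representative. *)
Lemma counting_ae (P : nat -> Prop) : {ae @counting nat R, forall n, P n} ->
  forall n, P n.
Proof.
move=> [N [mN N0 PN]] n; apply: contrapT => nPn.
have Nn : N n by exact: PN.
have : (@counting nat R [set n] <= @counting nat R N)%E.
  by apply: le_measure; rewrite ?inE// => _ ->.
rewrite N0 /counting asboolT; last exact: finite_set1.
by rewrite fset_set1 finmap.cardfs1 lee_fin ler10.
Qed.

Lemma coordD x y n : coord (x + y) n = coord x n + coord y n.
Proof.
have : Lp_class (Lp_repr (x + y)) = Lp_class (Lp_repr x + Lp_repr y).
  by rewrite Lp_classD !Lp_reprK.
by move/Lp_classP => /counting_ae /(_ n); apply.
Qed.

Lemma coordZ a x n : coord (a *: x) n = a * coord x n.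
Proof.
have : Lp_class (Lp_repr (a *: x)) = Lp_class (a *: Lp_repr x).
  by rewrite Lp_classZ !Lp_reprK.
by move/Lp_classP => /counting_ae /(_ n); apply.
Qed.

Lemma ell2_eq0 x : (forall n, coord x n = 0) -> x = 0.
Proof.
move=> x0; rewrite -[x]Lp_reprK -[0]Lp_reprK; apply/Lp_classP.
apply: aeW => n _; rewrite -[LHS]/(coord x n) x0.
by rewrite -[RHS]/(coord 0 n) -[0 in RHS](scale0r 0) coordZ mul0r.
Qed.

Lemma ell2_normE x : ((`|x| ^+ 2)%:E = \sum_(0 <= n <oo) (coord x n ^+ 2)%:E)%E.
Proof.
rewrite -powR_mulrn// -[x in LHS]Lp_reprK Lp_norm_powR ge0_integral_count.
  apply: eq_eseriesr => n _; rewrite powR_mulrn//.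
  by rewrite real_normK ?num_real.
by move=> n; rewrite lee_fin powR_ge0.
Qed.

Lemma sqsum_coord_le x N : sqsum (coord x) N <= `|x| ^+ 2.
Proof.
rewrite -lee_fin ell2_normE /sqsum -sumEFin -(big_mkord xpredT (fun n => (coord x n ^+ 2)%:E)).
by apply: nneseries_lim_ge => n _ _; rewrite lee_fin sqr_ge0.
Qed.

Lemma ell2_norm_le x (M : R) : 0 <= M ->
  (forall N, sqsum (coord x) N <= M ^+ 2) -> `|x| <= M.
Proof.
move=> M0 xM; rewrite -(@ler_pXn2r _ 2) ?nnegrE// -lee_fin ell2_normE.
apply: nneseries_le => [n|N]; first by rewrite lee_fin sqr_ge0.
by rewrite big_mkord sumEFin lee_fin; exact: xM.
Qed.

Lemma coord_sqr_le x n : coord x n ^+ 2 <= `|x| ^+ 2.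
Proof.
apply: le_trans (sqsum_coord_le x n.+1).
by rewrite /sqsum big_ord_recr/= lerDr sqsum_ge0.
Qed.

(* Odd positions carry the coordinates of [x]; the even ones carry damped copies
   in which every coordinate recurs infinitely often ([k |-> logn 2 k.+1] takes
   each value infinitely many times), so that [spread x] has infinitely many nonzero
   entries as soon as [x] is nonzero. *)
Definition spread x (j : nat) : R :=
  if odd j then coord x j./2 else 2^-1 ^+ j./2 * coord x (logn 2 (j./2).+1).

Lemma spreadD x y j : spread (x + y) j = spread x j + spread y j.
Proof. by rewrite /spread; case: ifP; rewrite coordD// mulrDr. Qed.

Lemma spreadZ a x j : spread (a *: x) j = a * spread x j.
Proof. by rewrite /spread; case: ifP; rewrite coordZ// mulrCA. Qed.

Lemma sqsum_spread x N : sqsum (spread x) N.*2 = sqsum (coord x) N +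
  \sum_(k < N) (2^-1 ^+ k * coord x (logn 2 k.+1)) ^+ 2.
Proof.
elim: N => [|N IH]; first by rewrite /sqsum !big_ord0 addr0.
rewrite /sqsum doubleS !big_ord_recr/= -[\sum_(k < N.*2) _]/(sqsum (spread x) N.*2) IH.
rewrite {1 2}/spread /= odd_double /= uphalf_double doubleK.
rewrite -/(sqsum (coord x) N); ring.
Qed.

Lemma sqsum_spread_ge x N : sqsum (coord x) N <= sqsum (spread x) N.*2.
Proof. by rewrite sqsum_spread lerDl sumr_ge0// => k _; exact: sqr_ge0. Qed.

(** The damped copies contribute at most the sum of the [2^-1 ^+ k * |x| ^+ 2], below twice
    [|x| ^+ 2]; with the odd positions this makes 3, rounded up to the square 4. *)
Lemma sqsum_spread_le x N : sqsum (spread x) N <= (2 * `|x|) ^+ 2.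
Proof.
apply: (le_trans (@sqsum_nd _ (spread x) N N.*2 _)); first by rewrite -addnn leq_addr.
rewrite sqsum_spread.
have : \sum_(k < N) (2^-1 ^+ k * coord x (logn 2 k.+1)) ^+ 2 <=
    \sum_(k < N) 2^-1 ^+ k * `|x| ^+ 2.
  apply: ler_sum => k _; rewrite exprMn ler_pM ?sqr_ge0 ?coord_sqr_le//.
  rewrite expr2 ler_piMr ?exprn_ge0// exprn_ile1 ?invr_ge0//.
  by rewrite invf_le1 ?ler1n.
rewrite -mulr_suml sum_half_powers.
have := sqsum_coord_le x N.
have : 0 <= (2^-1 : R) ^+ N * `|x| ^+ 2 by rewrite mulr_ge0 ?exprn_ge0.
rewrite (_ : (2 * `|x|) ^+ 2 = 4 * `|x| ^+ 2); last by ring.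
by have := sqr_ge0 `|x|; nra.
Qed.

Lemma spread_summable x : square_summable (spread x).
Proof. by exists ((2 * `|x|) ^+ 2) => N; exact: sqsum_spread_le. Qed.

Lemma spread_eventually0 x m : (forall k, (m <= k)%N -> spread x k = 0) -> x = 0.
Proof.
move=> x0; apply: ell2_eq0 => n.
(* As [m.*2.+1] is odd, [logn 2 k.+1 = n]: position [k.*2] carries coordinate [n], and it lies
   beyond [m]. *)
pose k := (2 ^ n * m.*2.+1).-1.
have kS : k.+1 = (2 ^ n * m.*2.+1)%N by rewrite /k prednK// muln_gt0 expn_gt0.
have mk : (m <= k.*2)%N.
  have : (m.*2.+1 <= k.+1)%N by rewrite kS leq_pmull// expn_gt0.
  by lia.
have := x0 _ mk; rewrite /spread odd_double doubleK kS.
rewrite lognM ?expn_gt0// lognX logn_prime// eqxx muln1.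
rewrite (_ : logn 2 m.*2.+1 = 0%N) ?addn0; last first.
  by apply: logn_coprime; rewrite coprime2n /= odd_double.
move=> /eqP; rewrite mulf_eq0 expf_eq0 invr_eq0 pnatr_eq0 andbF /= => /eqP.
exact.
Qed.

End ell2.

(** * The embedding of [l^2] into [L^p([0,1])] *)

Section ell2_to_Lp.
Context (R : realType) (p : R) (p1 : (1 <= p%:E)%E).
Local Notation E := (Lp (@lebesgue01 R) p1).
Implicit Types x y : ell2 R.

Definition Radmap x : E := Radlim p1 (spread x).

Lemma RadmapD x y : Radmap (x + y) = Radmap x + Radmap y.
Proof.
rewrite /Radmap -RadlimD; try exact: spread_summable.
by congr Radlim; apply/funext => j; exact: spreadD.
Qed.

Lemma RadmapZ a x : Radmap (a *: x) = a *: Radmap x.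
Proof.
rewrite /Radmap -RadlimZ; last exact: spread_summable.
by congr Radlim; apply/funext => j; exact: spreadZ.
Qed.

Lemma Radmap_bounds : exists c C : R, [/\ 0 < c, 0 < C &
  forall x, c * `|x| <= `|Radmap x| /\ `|Radmap x| <= C * `|x|].
Proof.
have [c [C [c0 C0 cC]]] := Radlim_bounds p1.
exists c, (C * 2); split=> //; first by rewrite mulr_gt0.
move=> x; have [lo hi] := cC _ (spread_summable x).
split; last first.
  rewrite -mulrA; apply: hi => [|N]; first by rewrite mulr_ge0.
  exact: sqsum_spread_le.
rewrite mulrC -ler_pdivlMr//; apply: ell2_norm_le => [|N].
  by rewrite divr_ge0// ltW.
apply: (le_trans (sqsum_spread_ge x N)).
rewrite -[leLHS]sqr_sqrtr ?sqsum_ge0// ler_pXn2r ?nnegrE ?sqrtr_ge0//.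
  by rewrite ler_pdivlMr// mulrC.
by rewrite divr_ge0// ltW.
Qed.

Lemma Radmap_neq0 x (f : LfunType (@lebesgue01 R) p1) m i : x != 0 ->
  Radmap x = Lp_class f -> (i < 2 ^ m)%N ->
  ~ {ae @lebesgue01 R, forall t, bin m t = i -> f t = 0}.
Proof.
move=> x0 xf im f0; move/eqP: x0; apply.
apply: (@spread_eventually0 _ x m).
exact: Radlim_coef_eq0 (spread_summable x) xf im f0.
Qed.

End ell2_to_Lp.

(** * Linear maps bounded above and below *)

Section bounded_below.
Context (R : realType) (W V : normedModType R) (f : W -> V) (c C : R).
Hypotheses (fD : forall x y, f (x + y) = f x + f y)
  (fZ : forall a x, f (a *: x) = a *: f x)
  (c_gt0 : 0 < c) (f_ge : forall x, c * `|x| <= `|f x|)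
  (f_le : forall x, `|f x| <= C * `|x|).

Let fB x y : f (x - y) = f x - f y.
Proof. by rewrite fD -scaleN1r fZ scaleN1r. Qed.

Let distW x y : `|x - y| <= c^-1 * `|f x - f y|.
Proof. by rewrite mulrC ler_pdivlMr// mulrC -fB. Qed.

Lemma bounded_below_submod_closed : GRing.submod_closed [in range f].
Proof.
split=> [|a _ _ /set_mem[x _ <-] /set_mem[y _ <-]].
  by rewrite inE; exists 0 => //; rewrite -(scale0r 0) fZ scale0r.
by rewrite inE; exists (a *: x + y) => //; rewrite fD fZ.
Qed.

Lemma bounded_below_isomorphic : isomorphic_onto W (range f).
Proof.
have f_lin : linear f by move=> a x y; rewrite fD fZ.
pose f_mixin := GRing.isLinear.Build R W V *:%R f f_lin.
pose F : {linear W -> V} := HB.pack f f_mixin.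
have FE x : F x = f x by [].
have fI : injective f.
  move=> x y fxy; apply/eqP; rewrite -subr_eq0 -normr_le0.
  by apply: (le_trans (distW x y)); rewrite fxy subrr normr0 mulr0.
(* Off the range the value of [g] is arbitrary; on the range [g] is Lipschitz with constant
   [c^-1]. *)
pose g v := get [set x | f x = v].
have fK : cancel F g.
  by move=> x; apply: fI; apply: (@getPex _ [set y | f y = f x]); exists x.
have gf x : g (f x) = x by exact: fK.
exists F, g; split => //.
- apply: bounded_linear_continuous; apply/linear_boundedP.
  exists C; split; first exact: num_real.
  by move=> k Ck x; apply: (le_trans (f_le x)); rewrite ler_wpM2r// ltW.
- apply/subspace_continuousP => _ [x _ <-].
  apply/cvgrPdist_le => /= e e0; apply/nbhs_ballP.
  exists (c * e); first by rewrite /= mulr_gt0.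
  move=> w; rewrite -ball_normE /= => xw [y _ yw].
  rewrite -{w}yw in xw *; rewrite /from_subspace !gf.
  apply: (le_trans (distW x y)); rewrite mulrC ler_pdivrMr// mulrC.
  exact: ltW.
Qed.

(** Preimages of points of the range approaching [v] form a Cauchy sequence by the lower bound on
    [f]; it converges in the complete space [W], and by continuity its limit is sent to [v]. *)
Lemma bounded_below_closed :
  (forall u : nat -> W, (forall e, 0 < e -> exists N, forall m n,
     (N <= m)%N -> (N <= n)%N -> `|u m - u n| <= e) ->
     exists l : W, u @ \oo --> l) ->
  closed (range f).
Proof.
move=> W_complete; apply/closure_id/seteqP; split; first exact: subset_closure.
move=> v clv.
have x_ n : {x | `|v - f x| <= n.+1%:R^-1}.
  apply: cid; have [|_ [[x _ <-] xv]] := clv (ball v n.+1%:R^-1).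
    by apply: nbhsx_ballx.
  by exists x; move: xv; rewrite -ball_normE /= => /ltW.
pose x n := sval (x_ n).
have xP n : `|v - f (x n)| <= n.+1%:R^-1 := svalP (x_ n).
have small e : 0 < e -> exists N, forall n, (N <= n)%N -> `|v - f (x n)| <= e.
  move=> e0; exists (Num.truncn e^-1) => n Nn; apply: (le_trans (xP n)).
  rewrite -[leRHS]invrK lef_pV2 ?posrE ?invr_gt0//.
  by apply: (le_trans (ltW (truncnS_gt _))); rewrite ler_nat ltnS.
have [e e0|l xl] := W_complete x.
  have [N NP] := small (c * e / 2) ltac:(by rewrite !mulr_gt0).
  exists N => m n Nm Nn; apply: (le_trans (distW _ _)).
  rewrite mulrC ler_pdivrMr// mulrC [leRHS]splitr.
  rewrite (_ : f (x m) - f (x n) = (v - f (x n)) - (v - f (x m))); last first.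
    by rewrite opprB [RHS]addrC addrA subrK.
  by rewrite (le_trans (ler_normB _ _))// lerD// NP.
exists l => //; apply/eqP; rewrite eq_sym -subr_eq0 -normr_le0.
apply/ler_addgt0Pr => e e0; rewrite add0r.
have [N NP] := small (e / 2) ltac:(by rewrite mulr_gt0).
have C0 : 0 < `|C| + 1 by rewrite ltr_pwDr.
have [M _ MP] := (cvgrPdist_le _ _).1 xl (e / 2 / (`|C| + 1))
  ltac:(by rewrite !mulr_gt0// invr_gt0).
pose k := maxn N M.
have -> : v - f l = (v - f (x k)) - f (l - x k) by rewrite fB opprB addrA subrK.
rewrite (le_trans (ler_normB _ _))// [leRHS]splitr lerD//.
  by apply: NP; exact: leq_maxl.
apply: (le_trans (f_le _)); apply: (@le_trans _ _ ((`|C| + 1) * `|l - x k|)).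
  by rewrite ler_wpM2r// (le_trans (ler_norm _))// lerDl.
by rewrite mulrC -ler_pdivlMr//; apply: MP; exact: leq_maxr.
Qed.

Lemma bounded_below_spaceable (S : set V) :
  (forall u : nat -> W, (forall e, 0 < e -> exists N, forall m n,
     (N <= m)%N -> (N <= n)%N -> `|u m - u n| <= e) ->
     exists l : W, u @ \oo --> l) ->
  (forall x, x != 0 -> S (f x)) ->
  spaceable W S /\ exists M : set V,
    [/\ closed M, GRing.submod_closed [in M], M `<=` S `|` [set 0] &
        isomorphic_onto W M].
Proof.
move=> W_complete fS.
have subS : range f `<=` S `|` [set 0].
  move=> _ [x _ <-]; have [->|/fS] := eqVneq x 0; last by left.
  by right; rewrite /= -(scale0r 0) fZ scale0r.
have submod := bounded_below_submod_closed.
have iso := bounded_below_isomorphic.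
by split; exists (range f); split => //; exact: bounded_below_closed.
Qed.

End bounded_below.

(** * Tonelli's theorem for one order of integration *)

Section tonelli.
Local Open Scope ereal_scope.
Context d1 d2 (T1 : measurableType d1) (T2 : measurableType d2) (R : realType).

Import HBNNSimple.

Lemma nd_integral_cvg d (T : measurableType d) (m : {measure set T -> \bar R})
    (g : (T -> \bar R)^nat) (f : T -> \bar R) :
  (forall n, measurable_fun setT (g n)) -> (forall n x, 0 <= g n x) ->
  (forall x, nondecreasing_seq (g ^~ x)) -> (forall x, g n x @[n --> \oo] --> f x) ->
  \int[m]_x g n x @[n --> \oo] --> \int[m]_x f x.
Proof.
move=> mg g0 ndg gf.
rewrite (_ : \int[m]_x f x = \int[m]_x limn (g ^~ x)); last first.
  by apply: eq_integral => x _; apply/esym/cvg_lim.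
by apply: cvg_monotone_convergence.
Qed.

(* The library's version assumes that both measures are sigma-finite; only the
   second one needs to be, since [m1 \x m2] integrates the sections along [m2]. *)
Variables (m1 : {measure set T1 -> \bar R}) (m2 : {sigma_finite_measure set T2 -> \bar R}).

(** On an indicator this is the definition of the product measure by sections; linearity gives
    simple functions. *)
Let tonelli_nnsfun (g : {nnsfun T1 * T2 >-> R}) :
  \int[m1 \x m2]_z (g z)%:E = \int[m1]_x fubini_F m2 (EFin \o g) x.
Proof.
rewrite integral_nnsfun// patch_setT sintegralE sfun_fubini_tonelli_FE.
have mk k : measurable (g @^-1` [set k]).
  by rewrite -[X in measurable X]setTI; exact: measurable_funP.
rewrite ge0_integral_fsum//; last 2 first.
- by move=> k; apply/measurable_funeM/measurable_fun_xsection.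
- move=> k x _; have [k0|k0] := leP 0%R k; first by rewrite mule_ge0.
  by rewrite preimage_nnfun0// xsection0 measure0 mule0.
apply: eq_fsbigr => _ /set_mem[z _ <-].
rewrite ge0_integralZl ?lee_fin//.
exact: (measurable_fun_xsection m2 (mk _)).
Qed.

Lemma tonelli_sigma_finite2 (f : T1 * T2 -> \bar R) : measurable_fun setT f ->
  (forall z, 0 <= f z) -> \int[m1 \x m2]_z f z = \int[m1]_x \int[m2]_y f (x, y).
Proof.
move=> mf f0; pose g := nnsfun_approx measurableT mf.
have mg n : measurable_fun setT (EFin \o g n) by exact/measurable_EFinP.
have mgx n x : measurable_fun setT (fun y => (g n (x, y))%:E).
  exact/measurable_EFinP/measurableT_comp.
have g0 n z : 0 <= (g n z)%:E by rewrite lee_fin; exact: fun_ge0.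
have ndg z : nondecreasing_seq (fun n => (g n z)%:E).
  by move=> a b ab; rewrite lee_fin; exact/lefP/nd_nnsfun_approx.
have gf z : (g n z)%:E @[n --> \oo] --> f z by exact: cvg_nnsfun_approx.
have l1 : \int[m1 \x m2]_z (g n z)%:E @[n --> \oo] --> \int[m1 \x m2]_z f z.
  exact: nd_integral_cvg.
have l2 : \int[m1]_x fubini_F m2 (EFin \o g n) x @[n --> \oo] -->
    \int[m1]_x \int[m2]_y f (x, y).
  apply: nd_integral_cvg => [n|n x|x a b ab|x].
  - exact: sfun_measurable_fun_fubini_tonelli_F.
  - by apply: integral_ge0 => y _; exact: g0.
  - by apply: ge0_le_integral => //;
      first [exact: mgx|move=> y _; exact: g0|move=> y _; exact: ndg].
  - by apply: nd_integral_cvg => *;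
      first [exact: mgx|exact: g0|exact: ndg|exact: gf].
move: l1; under eq_fun do rewrite tonelli_nnsfun.
by move/cvg_unique; apply.
Qed.

End tonelli.

(** * Integrals of products of functions of one variable *)

Section tensor.
Context (R : realType) (X : ptopologicalType).
Variable mu : {measure set (borel X) -> \bar R}.
Local Notation I := (unit_interval R).
Local Notation leb := (@lebesgue01 R).

Lemma measurable_fst_borel : measurable_fun setT (fst : borel (X * I)%type -> borel X).
Proof. by apply: continuous_borel_measurable => z; exact: cvg_fst. Qed.

Lemma measurable_snd_borel : measurable_fun setT (snd : borel (X * I)%type -> borel I).
Proof. by apply: continuous_borel_measurable => z; exact: cvg_snd. Qed.

Lemma integral_prod01 (F : borel X -> R) (G : borel I -> R) :
  measurable_fun setT F -> measurable_fun setT G ->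
  (forall x, 0 <= F x) -> (forall t, 0 <= G t) ->
  (\int[prod01 mu]_z (F z.1 * G z.2)%:E =
   \int[mu]_x (F x)%:E * \int[leb]_t (G t)%:E)%E.
Proof.
move=> mF mG F0 G0.
(* The identity, as a change of sigma-algebra: it carries [prod01 mu] to the product measure, to
   which Tonelli's theorem applies. *)
pose phi (z : borel (X * I)%type) : (borel X * borel I)%type := z.
have mphi : measurable_fun setT phi.
  rewrite (_ : phi = fun z => (z.1, z.2)); last by apply/funext => -[].
  by apply: measurable_fun_pair; [exact: measurable_fst_borel|exact: measurable_snd_borel].
pose h (z : (borel X * borel I)%type) := (F z.1 * G z.2)%:E.
have mh : measurable_fun setT h.
  apply/measurable_EFinP; apply: measurable_funM.
    exact: measurableT_comp mF measurable_fst.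
  exact: measurableT_comp mG measurable_snd.
have h0 z : (0 <= h z)%E by rewrite lee_fin mulr_ge0.
transitivity (\int[pushforward (prod01 mu) phi]_z h z)%E.
  apply/esym/(@ge0_integral_pushforward _ _ (borel (X * I)%type)
    (borel X * borel I)%type R phi mphi (prod01 mu) setT h) => //.
transitivity (\int[(mu \x leb)%E]_z h z)%E.
  exact: eq_measure_integral.
rewrite tonelli_sigma_finite2//.
have mFe : measurable_fun setT (fun x => (F x)%:E) by exact/measurable_EFinP.
have mGe : measurable_fun setT (fun t => (G t)%:E) by exact/measurable_EFinP.
have Fe0 x : setT x -> (0 <= (F x)%:E)%E by rewrite lee_fin.
have Ge0 t : setT t -> (0 <= (G t)%:E)%E by rewrite lee_fin.
have K0 : (0 <= \int[leb]_t (G t)%:E)%E by exact: integral_ge0.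
rewrite -ge0_integralZr//; apply: eq_integral => x _.
by rewrite -ge0_integralZl ?lee_fin//; apply: eq_integral => t _; rewrite -EFinM.
Qed.

End tensor.

(** * Tensor products in [L^p] and nowhere integrability *)

Section Lp_tensor.
Context (R : realType) (p : R) (p1 : (1 <= p%:E)%E) (X : ptopologicalType).
Variable mu : {measure set (borel X) -> \bar R}.
Local Notation I := (unit_interval R).
Local Notation leb := (@lebesgue01 R).
Implicit Types (f : LfunType mu p1) (g : LfunType leb p1).

Let p_ge1 : 1 <= p. Proof. by rewrite -lee_fin. Qed.
Let p_gt0 : 0 < p. Proof. exact: lt_le_trans p_ge1. Qed.
Let p_neq0 : p != 0. Proof. by rewrite gt_eqF. Qed.

Definition tensor (f : borel X -> R) (g : borel I -> R) (z : borel (X * I)%type) : R :=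
  f z.1 * g z.2.

Lemma measurable_tensor (f : borel X -> R) (g : borel I -> R) :
  measurable_fun setT f -> measurable_fun setT g ->
  measurable_fun setT (tensor f g).
Proof.
move=> mf mg; apply: measurable_funM.
  exact: measurableT_comp mf (@measurable_fst_borel R X).
exact: measurableT_comp mg (@measurable_snd_borel R X).
Qed.

Lemma integral_tensor_powR (r : R) (f : borel X -> R) (g : borel I -> R) :
  measurable_fun setT f -> measurable_fun setT g ->
  (\int[prod01 mu]_z (`|tensor f g z| `^ r)%:E =
   \int[mu]_x (`|f x| `^ r)%:E * \int[leb]_t (`|g t| `^ r)%:E)%E.
Proof.
move=> mf mg; rewrite -integral_prod01.
- by apply: eq_integral => z _; rewrite normrM powRM.
- by apply/measurable_EFinP; exact: measurable_powR_norm.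
- by apply/measurable_EFinP; exact: measurable_powR_norm.
- by move=> x; exact: powR_ge0.
- by move=> t; exact: powR_ge0.
Qed.

Lemma tensor_Lfun f g : tensor f g \in Lfun (prod01 mu) p%:E.
Proof.
apply/(Lfun_finP _ p1); split; first exact: measurable_tensor.
by rewrite integral_tensor_powR// -!Lp_norm_powR -EFinM ltry.
Qed.

Definition Lp_tensor f (y : Lp leb p1) : Lp (prod01 mu) p1 :=
  Lp_class (Lfun_Sub p1 (tensor_Lfun f (Lp_repr y))).

Lemma norm_Lp_tensor f (y : Lp leb p1) :
  `|Lp_tensor f y| = `|Lp_class f| * `|y|.
Proof.
have pow_eq : `|Lp_tensor f y| `^ p = (`|Lp_class f| * `|y|) `^ p.
  apply: EFin_inj; rewrite /Lp_tensor (Lp_norm_powR (Lfun_Sub _ _)).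
  rewrite integral_tensor_powR// powRM// EFinM -{2}[y]Lp_reprK.
  by rewrite !Lp_norm_powR.
rewrite -(powRK p_neq0 (normr_ge0 (Lp_tensor f y))) pow_eq.
by rewrite powRK// mulr_ge0.
Qed.

(** The strip over a null set is null even when [mu] has infinite mass, as infinity times 0 is 0. It
    makes [Lp_tensor] linear although it goes through representatives. *)
Lemma ae_prod01_snd (P : borel I -> Prop) : {ae leb, forall t, P t} ->
  {ae prod01 mu, forall z, P z.2}.
Proof.
move=> [N [mN N0 PN]]; exists (setT `*` N); split.
- rewrite (_ : setT `*` N = setT `&` snd @^-1` N); last first.
    by apply/seteqP; split => z [].
  exact: (@measurable_snd_borel R X).
- by rewrite [LHS]prod01X// N0 mule0.
- by move=> z /= Pz; split => //; exact: PN.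
Qed.

Lemma Lp_tensorD f (y1 y2 : Lp leb p1) :
  Lp_tensor f (y1 + y2) = Lp_tensor f y1 + Lp_tensor f y2.
Proof.
rewrite /Lp_tensor -Lp_classD; apply/Lp_classP.
have : Lp_class (Lp_repr (y1 + y2)) = Lp_class (Lp_repr y1 + Lp_repr y2).
  by rewrite Lp_classD !Lp_reprK.
move=> /Lp_classP /ae_prod01_snd.
apply: (@filterS _ _ (ae_filter_ringOfSetsType (prod01 mu))) => z /(_ Logic.I) h _.
by rewrite /= /tensor h mulrDr.
Qed.

Lemma Lp_tensorZ f a (y : Lp leb p1) : Lp_tensor f (a *: y) = a *: Lp_tensor f y.
Proof.
rewrite /Lp_tensor -Lp_classZ; apply/Lp_classP.
have : Lp_class (Lp_repr (a *: y)) = Lp_class (a *: Lp_repr y).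
  by rewrite Lp_classZ !Lp_reprK.
move=> /Lp_classP /ae_prod01_snd.
apply: (@filterS _ _ (ae_filter_ringOfSetsType (prod01 mu))) => z /(_ Logic.I) h _.
by rewrite /= /tensor h mulrCA.
Qed.

Lemma nbhs_bin (y : I) (V : set I) : nbhs y V ->
  exists m i, (i < 2 ^ m)%N /\ [set t | bin m t = i] `<=` V.
Proof.
move=> [_ [[B oB <-] By] BV].
have /nbhs_ballP[e /= e0 eB] : nbhs (unit_val y) B by exact: open_nbhs_nbhs.
have [m me] : exists m, (2^-1 : R) ^+ m < e.
  have : (1 : R) * 2^-1 ^+ n @[n --> \oo] --> 0.
    by apply: cvg_geometric; rewrite ger0_norm ?invr_ge0// invf_lt1// ltr1n.
  move=> /cvgrPdist_lt /(_ _ e0) [n _ /(_ n (leqnn n))].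
  by rewrite mul1r sub0r normrN ger0_norm ?exprn_ge0// => ?; exists n.
(* Only [y = 1] lies in the null extra bin; the last proper bin, within [2^-1 ^+ m] of 1, then takes
   its place. *)
pose i := minn (bin m y) (2 ^ m).-1.
have pm : (0 < 2 ^ m)%N by rewrite expn_gt0.
exists m, i; split; first by rewrite /i; lia.
move=> t /= ti; apply: BV; apply: eB.
rewrite /ball /= -[set_val t]/(unit_val t).
have := bin_eq m t i; rewrite ti eqxx => /esym /andP[it ti'].
have := bin_eq m y (bin m y); rewrite eqxx => /esym /andP[iy yi].
have := bin_le m y; have /andP[_ y1] := unit_val_itv y.
set u := unit_val y in iy yi y1 *; set v := unit_val t in it ti' *.
move: it ti' iy yi; rewrite -[i.+1]addn1 -[(bin m y).+1]addn1 !natrD !mulrDl mul1r.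
move=> it ti' iy yi; rewrite leq_eqVlt => /predU1P[ym|ylt].
  have iE : i%:R * (2^-1 : R) ^+ m = 1 - 2^-1 ^+ m.
    rewrite /i ym (minn_idPr _) ?leq_pred// -subn1 natrB// mulrBl mul1r.
    by rewrite natrX -exprMn divff// expr1n.
  rewrite iE in it ti'; have uE : u = 1.
    apply/eqP; rewrite eq_le y1 /=; move: iy.
    by rewrite ym natrX -exprMn divff// expr1n.
  by rewrite uE ltr_distlC; apply/andP; split; lra.
have iE : i = bin m y by apply/minn_idPl; rewrite -ltnS prednK.
by rewrite iE in it ti'; rewrite ltr_distlC; apply/andP; split; lra.
Qed.

Lemma nowhere_L_tensor f g :
  (forall q, (p%:E < q)%E -> nowhere_L mu q f) ->
  (forall m i, (i < 2 ^ m)%N -> ~ {ae leb, forall t, bin m t = i -> g t = 0}) ->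
  forall q, (p%:E < q)%E -> @nowhere_L R (X * I)%type (prod01 mu) q (tensor f g).
Proof.
move=> fq gneq0.
have fin r : p < r -> @nowhere_L R (X * I)%type (prod01 mu) r%:E (tensor f g).
  move=> pr W oW [[x y] Wxy]; apply/negP.
  have r_ge1 : (1 <= r%:E)%E by rewrite lee_fin (le_trans p_ge1)// ltW.
  have r0 : r != 0 by rewrite gt_eqF// (lt_trans p_gt0).
  move=> /(Lfun_finP _ r_ge1) [mW]; apply/negP; rewrite -leNgt.
  have [[/= U V] [/= xU yV] UVW] : nbhs (x, y) W by exact: open_nbhs_nbhs.
  have [m [i [im iV]]] := nbhs_bin yV.
  pose U' : set X := U°; pose D : set (borel I) := [set t | bin m t = i].
  have oU' : open U' by exact: open_interior.
  have mU' : measurable (U' : set (borel X)) by exact: sub_sigma_algebra.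
  have mf' : measurable_fun setT (f \_ U' : borel X -> R).
    by apply/(measurable_restrictT _ mU')/measurable_funTS.
  have mD : measurable D by exact: measurable_bin.
  have mg' : measurable_fun setT (g \_ D : borel I -> R).
    by apply/(measurable_restrictT _ mD)/measurable_funTS.
  have fy : (\int[mu]_z (`|(f \_ U') z| `^ r)%:E = +oo)%E.
    have /negP := fq r%:E pr _ oU' (ex_intro _ x xU).
    apply: contra_notP => /eqP; rewrite -ltey => h.
    exact/(Lfun_finP _ r_ge1).
  (* Positivity suffices, infinity times a positive value being infinite; a zero integral would make
     [g] vanish almost everywhere on the bin. *)
  have g0 : (0 < \int[leb]_t (`|(g \_ D) t| `^ r)%:E)%E.
    rewrite lt0e integral_ge0 ?andbT; last by move=> t _; rewrite lee_fin powR_ge0.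
    apply/negP => /eqP g0; apply: (gneq0 _ _ im).
    have : (\int[leb]_t `|(`|(g \_ D) t| `^ r)%:E| = 0)%E.
      by rewrite -[RHS]g0; apply: eq_integral => t _; rewrite gee0_abs// lee_fin powR_ge0.
    move=> /(ae_eq_integral_abs leb measurableT (measurable_powR_norm r mg')).
    apply: (@filterS _ _ (ae_filter_ringOfSetsType leb)) => t /(_ Logic.I) /= [] gt ti.
    have /eqP := powR_eq0_eq0 gt; rewrite normr_eq0 => /eqP.
    by rewrite patchE mem_set.
  have : (\int[prod01 mu]_z (`|tensor (f \_ U') (g \_ D) z| `^ r)%:E = +oo)%E.
    by rewrite integral_tensor_powR// fy gt0_mulye.
  move=> <-; apply: ge0_le_integral => //.
  - by apply: measurable_powR_norm; exact: measurable_tensor.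
  - exact: measurable_powR_norm.
  - move=> z _; rewrite lee_fin /tensor !patchE.
    case: ifPn => [/set_mem zU|_]; last by rewrite mul0r normr0 powR0// powR_ge0.
    case: ifPn => [/set_mem zD|_]; last by rewrite mulr0 normr0 powR0// powR_ge0.
    by rewrite mem_set//; case: z zU zD => a t /= zU zD; apply: UVW; split;
      [exact: interior_subset zU|exact: iV].
move=> [r|_|//]; first by rewrite lte_fin; exact: fin.
(* The case [q = +oo]. Where [|h| <= C], one has [|h| ^ (p + 1) <= C * |tensor f g| ^ p]; since the
   tensor is in [L^p], this would put [h] in [L^(p+1)], even on a space of infinite measure. *)
move=> W oW W0; apply/negP => hy.
have := fin (p + 1) ltac:(by rewrite ltrDl) W oW W0; apply/negP; rewrite negbK.
have p1_ge1 : (1 <= (p + 1)%:E)%E by rewrite lee_fin lerDr ltW.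
pose h : borel (X * I)%type -> R := tensor f g \_ W.
rewrite -[_ \_ W]/h; have {}hy : h \in Lfun (prod01 mu) +oo%E by exact: hy.
have [mh hfin] : measurable_fun setT h /\ ('N[prod01 mu]_+oo%E[EFin \o h] < +oo)%E.
  by move: hy => /andP[]; rewrite !inE.
have [C C0 hC] : exists2 C : R, 0 <= C & {ae prod01 mu, forall z, `|h z| <= C}.
  (* When the total measure is 0 the norm is 0 by convention, and the whole space serves as
     exceptional set. *)
  move: hfin; rewrite unlock; case: ifPn => [_|mu0 _]; last first.
    exists 0 => //; exists setT; split => //.
    by apply/eqP; rewrite eq_le measure_ge0 andbT leNgt.
  have := ess_sup_ge (prod01 mu) (abse \o (EFin \o h)).
  case: (ess_sup _ _) => [r|//|] hle _; [exists `|r| => //|exists 0 => //];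
    apply: (@filterS _ _ (ae_filter_ringOfSetsType (prod01 mu)) _ _ _ hle) => z //=.
  by rewrite lee_fin => /le_trans; apply; exact: ler_norm.
apply/(Lfun_finP _ p1_ge1); split => //.
have mt := measurable_tensor (f := f) (g := g).
apply: (@le_lt_trans _ _ (\int[prod01 mu]_z (C%:E * (`|tensor f g z| `^ p)%:E))%E).
  apply: ae_ge0_le_integral => //.
  - exact: measurable_powR_norm.
  - by move=> z _; rewrite mule_ge0 ?lee_fin ?powR_ge0.
  - by apply: measurable_funeM; apply: measurable_powR_norm; exact: mt.
  - apply: (@filterS _ _ (ae_filter_ringOfSetsType (prod01 mu)) _ _ _ hC) => z hz _.
    rewrite -EFinM lee_fin -(@mulr_powRB1 _ _ (p + 1)) ?addr_gt0// addrK.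
    rewrite ler_pM ?powR_ge0// ge0_ler_powR ?nnegrE// ?(ltW p_gt0)//.
    by rewrite /h patchE; case: ifP; rewrite ?normr0.
rewrite ge0_integralZl//; last by apply: measurable_powR_norm; exact: mt.
by rewrite integral_tensor_powR// -!Lp_norm_powR -!EFinM ltry.
Qed.

End Lp_tensor.

(** A null function is in [L^(p+1)] on the whole space, which is open and nonempty. The strict
    inequality is what keeps tensoring with [f] bounded below. *)
Lemma Sp_norm_gt0 (R : realType) (p : R) (p1 : (1 <= p%:E)%E)
    (X : ptopologicalType) (mu : {measure set (borel X) -> \bar R})
    (f : LfunType mu p1) :
  (forall q, (p%:E < q)%E -> nowhere_L mu q f) -> 0 < `|Lp_class f|.
Proof.
move=> fq; rewrite normr_gt0; apply/eqP => f0.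
have p0 : 0 < p by rewrite (lt_le_trans ltr01)// -lee_fin.
have q1 : (1 <= (p + 1)%:E)%E by rewrite lee_fin lerDr ltW.
have pq : (p%:E < (p + 1)%:E)%E by rewrite lte_fin ltrDl.
have := fq _ pq _ openT (ex_intro _ point Logic.I); rewrite patch_setT => /negP; apply.
apply/(Lfun_finP _ q1); split; first exact: measurable_funP.
have fae : Lp_class f = Lp_class (0 : LfunType mu p1).
  by rewrite f0; apply/(addIr (Lp_class 0)); rewrite -Lp_classD add0r addr0.
rewrite (ae_eq_integral (cst 0%E)) ?integral0//.
  by apply: measurable_powR_norm; exact: measurable_funP.
move/Lp_classP : fae; apply: filterS => x /(_ Logic.I) /= -> _.
by rewrite normr0 powR0// gt_eqF// addr_gt0.
Qed.

(** * The embedding of [l^2] into [L^p] of the product *)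

Section Lp_tensor_Radmap.
Context (R : realType) (p : R) (p1 : (1 <= p%:E)%E) (X : ptopologicalType).
Variables (mu : {measure set (borel X) -> \bar R}) (f : LfunType mu p1).
Hypothesis f_nowhere : forall q, (p%:E < q)%E -> nowhere_L mu q f.

Definition Lp_tensor_Radmap (x : ell2 R) : Lp (prod01 mu) p1 :=
  Lp_tensor f (Radmap p1 x).

Lemma Lp_tensor_RadmapD x y :
  Lp_tensor_Radmap (x + y) = Lp_tensor_Radmap x + Lp_tensor_Radmap y.
Proof. by rewrite /Lp_tensor_Radmap RadmapD Lp_tensorD. Qed.

Lemma Lp_tensor_RadmapZ a x :
  Lp_tensor_Radmap (a *: x) = a *: Lp_tensor_Radmap x.
Proof. by rewrite /Lp_tensor_Radmap RadmapZ Lp_tensorZ. Qed.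

Lemma Lp_tensor_Radmap_bounds : exists c C : R, [/\ 0 < c,
  forall x, c * `|x| <= `|Lp_tensor_Radmap x| &
  forall x, `|Lp_tensor_Radmap x| <= C * `|x|].
Proof.
have [c [C [c0 C0 bounds]]] := Radmap_bounds p1.
exists (`|Lp_class f| * c), (`|Lp_class f| * C).
split=> [|x|x]; first by rewrite mulr_gt0// Sp_norm_gt0.
- by rewrite norm_Lp_tensor -mulrA ler_wpM2l//; have [] := bounds x.
- by rewrite norm_Lp_tensor -mulrA ler_wpM2l//; have [] := bounds x.
Qed.

Lemma Lp_tensor_Radmap_Sp x : x != 0 ->
  @Sp R (Datatypes_prod__canonical__topology_structure_PointedTopological X
    (Defs_unit_interval__canonical__topology_structure_PointedTopological R))
    (prod01 mu) p p1 (Lp_tensor_Radmap x).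
Proof.
move=> x0.
pose h := Lfun_Sub p1 (tensor_Lfun f (Lp_repr (Radmap p1 x))).
suff h_nowhere : forall q, (p%:E < q)%E ->
    @nowhere_L R (X * unit_interval R)%type (prod01 mu) q h.
  exact: (ex_intro2 _ _ h h_nowhere erefl).
apply: nowhere_L_tensor => // m i im.
exact: (Radmap_neq0 x0 (esym (Lp_reprK _)) im).
Qed.

End Lp_tensor_Radmap.

Theorem theorem3p5 (R : realType) (p : R) (p1 : (1 <= p%:E)%E)
    (X : ptopologicalType) (mu : {measure set (borel X) -> \bar R}) :
  Sp mu p1 !=set0 ->
  spaceable (ell2 R) (Sp (prod01 mu) p1) /\
  exists M : set (Lp (prod01 mu) p1),
    [/\ closed M, GRing.submod_closed [in M],
        M `<=` Sp (prod01 mu) p1 `|` [set 0] & isomorphic_onto (ell2 R) M].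
Proof.
move=> [_ [f f_nowhere _]].
have [c [C [c0 T_ge T_le]]] := Lp_tensor_Radmap_bounds f_nowhere.
have T_Sp := Lp_tensor_Radmap_Sp f_nowhere.
have complete := @Lp_complete _ _ _ (@counting nat R) _ (lee1n 2).
have spaceableT := @bounded_below_spaceable R (ell2 R) (Lp (prod01 mu) p1)
  (Lp_tensor_Radmap f) c C (Lp_tensor_RadmapD f) (Lp_tensor_RadmapZ f)
  c0 T_ge T_le _ complete T_Sp.
(* The goal differs only by inheritance paths between structures on [Lp]: the
   kernel checks this conversion at [Qed] in seconds, unification takes minutes. *)
exact_no_check spaceableT.
Qed.
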